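(* Let $k \in \mathbb{Z}$ and let $H_k = \mathbb{Z}^2 \rtimes G_2$, where $G_2 = \langle a, b \mid aba^{-1}b \rangle$ and the generators $a$ and $b$ act on $\mathbb{Z}^2$ by multiplication by the matrices $A = \begin{pmatrix} 0 & 1 \\ 1 & 0 \end{pmatrix}$ and $B_k = \begin{pmatrix} 0 & 1 \\ -1 & k \end{pmatrix}$, respectively. Then for every positive integer $n$, the number $m_n(H_k)$ of maximal subgroups of $H_k$ of index $n$ is as follows, where $p$ stands for a prime: $$m_n(H_k) = \begin{cases} n^2 + n + 1 & \text{if } n = p \text{ and } p \mid k-2,\\ 2n + 1 & \text{if } n = p \text{ and } p \mid k+2 \text{ with } p > 2,\\ n + 1 & \text{if } n = p \text{ and } p \nmid (k-2)(k+2),\\ n & \text{if } n = p^2 \text{ and } p \nmid (k-2)(k+2),\\ 0 & \text{otherwise.} \end{cases}$$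
   Context: For a finitely generated group $G$, $m_n(G)$ denotes the number of maximal subgroups of $G$ of index $n$. Elements of $\mathbb{Z}^2$ are viewed as column vectors. Since $A, B_k \in \mathrm{GL}_2(\mathbb{Z})$ and $A B_k A^{-1} B_k = I_2$, the assignment $a \mapsto A$, $b \mapsto B_k$ defines an action of $G_2$ on $\mathbb{Z}^2$; in the semidirect product $H_k$, $G_2$ acts on $\mathbb{Z}^2$ by conjugation via this action. *)

(* Defs.v *)
From HB Require Import structures.
From mathcomp Require Import all_boot all_order all_algebra.
From mathcomp Require Import boolp classical_sets functions cardinality.

Set Implicit Arguments.
Unset Strict Implicit.
Unset Printing Implicit Defensive.

Import GRing.Theory.

Local Open Scope quotient_scope.
Local Open Scope classical_set_scope.
Local Open Scope card_scope.
Local Open Scope group_scope.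

(* [group_closed] from monoid.v takes a boolean predicate, hence [mem M]. *)
Definition is_subgroup (G : groupType) (M : set G) : Prop :=
  group_closed (mem M).

Definition is_maximal_subgroup (G : groupType) (M : set G) : Prop :=
  [/\ is_subgroup M, M <> [set: G] &
      forall K : set G, is_subgroup K -> M `<=` K -> K = M \/ K = [set: G]].

Definition left_cosets (G : groupType) (M : set G) : set (set G) :=
  [set [set x * y | y in M] | x in [set: G]].

Definition has_index (G : groupType) (M : set G) (n : nat) : Prop :=
  left_cosets M #= `I_n.

(* m_n(G) is the cardinality of this set. *)
Definition maximal_subgroups (G : groupType) (n : nat) : set (set G) :=
  [set M | is_maximal_subgroup M /\ has_index M n].
Arguments maximal_subgroups : clear implicits.

(* Words in the letters of T and their formal inverses: (x, false) stands for
   x and (x, true) for x^-1. *)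
Definition word (T : Type) := seq (T * bool).

Definition inv_word (T : Type) (w : word T) : word T :=
  rev [seq (l.1, ~~ l.2) | l <- w].

Inductive pres_eq (T : Type) (R : set (word T)) : word T -> word T -> Prop :=
| pres_refl w : pres_eq R w w
| pres_sym w1 w2 : pres_eq R w1 w2 -> pres_eq R w2 w1
| pres_trans w1 w2 w3 : pres_eq R w1 w2 -> pres_eq R w2 w3 -> pres_eq R w1 w3
| pres_cat v1 v2 w1 w2 :
    pres_eq R v1 v2 -> pres_eq R w1 w2 -> pres_eq R (v1 ++ w1) (v2 ++ w2)
| pres_cancel x e : pres_eq R [:: (x, e); (x, ~~ e)] [::]
| pres_relator r : R r -> pres_eq R r [::].

Section Presentation.
Variables (T : choiceType) (R : set (word T)).

Definition pres_rel : rel (word T) := fun w1 w2 => `[< pres_eq R w1 w2 >].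

Lemma pres_rel_equiv : equiv_class_of pres_rel.
Proof.
split=> [w|w1 w2|w2 w1 w3].
- exact/asboolP/pres_refl.
- by apply/asboolP/asboolP; exact: pres_sym.
- by move=> /asboolP h1 /asboolP h2; apply/asboolP/(pres_trans h1 h2).
Qed.

Canonical pres_equiv_rel := EquivRelPack pres_rel_equiv.

Definition presented := {eq_quot pres_equiv_rel}.
HB.instance Definition _ := EqQuotient.on presented.
HB.instance Definition _ := Choice.on presented.

Definition pres_class (w : word T) : presented := \pi w.

Lemma pres_classK (g : presented) : pres_class (repr g) = g.
Proof. exact: reprK. Qed.

Lemma presP (w1 w2 : word T) :
  pres_eq R w1 w2 <-> pres_class w1 = pres_class w2.
Proof.
split=> [h|/eqmodP /asboolP //]; first exact/eqmodP/asboolP.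
Qed.

Lemma pres_reprK (w : word T) : pres_eq R (repr (pres_class w)) w.
Proof. by apply/presP; exact: pres_classK. Qed.

Lemma pres_inv_word (w1 w2 : word T) :
  pres_eq R w1 w2 -> pres_eq R (inv_word w1) (inv_word w2).
Proof.
have invr (w : word T) : pres_eq R (w ++ inv_word w) [::].
  elim: w => [|[x e] w IH]; first exact: pres_refl.
  have -> : ((x, e) :: w) ++ inv_word ((x, e) :: w) =
      ([:: (x, e)] ++ (w ++ inv_word w)) ++ [:: (x, ~~ e)].
    by rewrite /inv_word /= rev_cons -cats1 -!catA.
  apply: (pres_trans (w2 := ([:: (x, e)] ++ [::]) ++ [:: (x, ~~ e)])).
    exact: pres_cat (pres_cat (pres_refl R _) IH) (pres_refl R _).
  exact: pres_cancel.
have invK (w : word T) : inv_word (inv_word w) = w.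
  rewrite /inv_word map_rev revK -map_comp -[RHS]map_id.
  by apply: eq_map => -[x e] /=; rewrite negbK.
have invl (w : word T) : pres_eq R (inv_word w ++ w) [::].
  by rewrite -{2}(invK w); exact: invr.
move=> h.
apply: (pres_trans (w2 := inv_word w1 ++ (w2 ++ inv_word w2))).
  rewrite -{1}(cats0 (inv_word w1)).
  by apply: pres_cat; [exact: pres_refl|exact/pres_sym/invr].
rewrite catA -{2}(cat0s (inv_word w2)).
apply: pres_cat; last exact: pres_refl.
apply: pres_trans (invl w1); apply: pres_cat; first exact: pres_refl.
exact: pres_sym.
Qed.

Definition pres_one : presented := pres_class [::].
Definition pres_mul (g h : presented) : presented :=
  pres_class (repr g ++ repr h).
Definition pres_inv (g : presented) : presented :=
  pres_class (inv_word (repr g)).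

Lemma pres_mulE (w1 w2 : word T) :
  pres_mul (pres_class w1) (pres_class w2) = pres_class (w1 ++ w2).
Proof. by apply/presP/pres_cat; exact: pres_reprK. Qed.

Lemma pres_mulA : associative pres_mul.
Proof.
by move=> x y z; rewrite -(pres_classK x) -(pres_classK y) -(pres_classK z) !pres_mulE catA.
Qed.

Lemma pres_mul1 : left_id pres_one pres_mul.
Proof. by move=> x; rewrite -(pres_classK x) pres_mulE. Qed.

Lemma pres_mulr1 : right_id pres_one pres_mul.
Proof. by move=> x; rewrite -(pres_classK x) pres_mulE cats0. Qed.

Lemma pres_mulV : left_inverse pres_one pres_inv pres_mul.
Proof.
move=> g; rewrite -{2}(pres_classK g) pres_mulE; apply/presP.
elim: (repr g) => [|[x e] w IH]; first exact: pres_refl.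
rewrite /inv_word /= rev_cons -cats1 -/(inv_word w) -catA.
apply: pres_trans IH; apply: pres_cat; first exact: pres_refl.
have h : pres_eq R [:: (x, ~~ e); (x, e)] [::].
  by rewrite -{2}(negbK e); exact: pres_cancel.
exact: (pres_cat h (pres_refl R w)).
Qed.

Lemma pres_mulrV : right_inverse pres_one pres_inv pres_mul.
Proof.
move=> g; have := pres_mulV (pres_inv g) => h.
rewrite -[pres_mul g _]pres_mul1 -h -pres_mulA; congr pres_mul.
by rewrite pres_mulA pres_mulV pres_mul1.
Qed.

HB.instance Definition _ := isGroup.Build presented
  pres_mulA pres_mul1 pres_mulr1 pres_mulV pres_mulrV.

Definition pres_gen (x : T) : presented := pres_class [:: (x, false)].

Section Lift.
Variables (G : groupType) (f : T -> G).

Definition eval_word (w : word T) : G :=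
  \prod_(l <- w) (if l.2 then (f l.1)^-1 else f l.1).

Hypothesis fR : forall r, R r -> eval_word r = 1.

Lemma eval_pres (w1 w2 : word T) :
  pres_eq R w1 w2 -> eval_word w1 = eval_word w2.
Proof.
elim=> {w1 w2} //.
- by move=> w1 w2 w3 _ -> _ ->.
- by move=> v1 v2 w1 w2 _ + _; rewrite /eval_word !big_cat /= => -> ->.
- move=> x e; rewrite /eval_word !big_cons big_nil mulg1 /=.
  by case: e; rewrite ?mulVg ?mulgV.
- by move=> r /fR ->; rewrite /eval_word big_nil.
Qed.

Definition pres_lift of (forall r, R r -> eval_word r = 1) : presented -> G :=
  fun g => eval_word (repr g).

Lemma pres_lift_morphism : monoid.monoid_morphism (pres_lift fR).
Proof.
split=> [|g h]; rewrite /pres_lift (eval_pres (pres_reprK _)).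
  by rewrite /eval_word big_nil.
by rewrite /eval_word big_cat.
Qed.

Lemma pres_lift_gen x : pres_lift fR (pres_gen x) = f x.
Proof.
by rewrite /pres_lift (eval_pres (pres_reprK _)) /eval_word big_seq1.
Qed.

End Lift.

HB.instance Definition _ (G : groupType) (f : T -> G) fR :=
  isUMagmaMorphism.Build presented G (@pres_lift G f fR)
    (pres_lift_morphism fR).

End Presentation.

Inductive gen2 := gen_a | gen_b.

Definition bool_of_gen2 g := if g is gen_a then true else false.
Definition gen2_of_bool b := if b then gen_a else gen_b.
Lemma bool_of_gen2K : cancel bool_of_gen2 gen2_of_bool.
Proof. by case. Qed.
HB.instance Definition _ := Choice.copy gen2 (can_type bool_of_gen2K).

Definition relators_G2 : set (word gen2) :=
  [set [:: (gen_a, false); (gen_b, false); (gen_a, true); (gen_b, false)]].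

Definition G2 : groupType := presented relators_G2.
Definition G2_a : G2 := pres_gen relators_G2 gen_a.
Definition G2_b : G2 := pres_gen relators_G2 gen_b.

Record GL2Z := MkGL2Z { GL2Z_mx : 'M[int]_2; GL2Z_unit : GL2Z_mx \in unitmx }.
HB.instance Definition _ := [isSub for GL2Z_mx].
HB.instance Definition _ := [Choice of GL2Z by <:].

Section GL2Z.
Local Open Scope ring_scope.

Definition GL2Z_one : GL2Z := MkGL2Z (unitmx1 _ _).

Lemma GL2Z_mul_subproof (M N : GL2Z) : GL2Z_mx M *m GL2Z_mx N \in unitmx.
Proof. by rewrite unitmx_mul (GL2Z_unit M) (GL2Z_unit N). Qed.
Definition GL2Z_mul (M N : GL2Z) : GL2Z := MkGL2Z (GL2Z_mul_subproof M N).

Lemma GL2Z_inv_subproof (M : GL2Z) : invmx (GL2Z_mx M) \in unitmx.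
Proof. by rewrite unitmx_inv (GL2Z_unit M). Qed.
Definition GL2Z_inv (M : GL2Z) : GL2Z := MkGL2Z (GL2Z_inv_subproof M).

Lemma GL2Z_mulA : associative GL2Z_mul.
Proof. by move=> M N P; apply/val_inj/mulmxA. Qed.
Lemma GL2Z_mul1 : left_id GL2Z_one GL2Z_mul.
Proof. by move=> M; apply/val_inj/mul1mx. Qed.
Lemma GL2Z_mulr1 : right_id GL2Z_one GL2Z_mul.
Proof. by move=> M; apply/val_inj/mulmx1. Qed.
Lemma GL2Z_mulV : left_inverse GL2Z_one GL2Z_inv GL2Z_mul.
Proof. by move=> M; apply/val_inj/mulVmx/(GL2Z_unit M). Qed.
Lemma GL2Z_mulrV : right_inverse GL2Z_one GL2Z_inv GL2Z_mul.
Proof. by move=> M; apply/val_inj/mulmxV/(GL2Z_unit M). Qed.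

HB.instance Definition _ := isGroup.Build GL2Z
  GL2Z_mulA GL2Z_mul1 GL2Z_mulr1 GL2Z_mulV GL2Z_mulrV.

Definition mx2 (x y z t : int) : 'M[int]_2 :=
  \matrix_(i, j) if i == 0 then (if j == 0 then x else y)
                 else (if j == 0 then z else t).

Definition matA : 'M[int]_2 := mx2 0 1 1 0.
Definition matB (k : int) : 'M[int]_2 := mx2 0 1 (-1) k.

Lemma mx2_mul x y z t x' y' z' t' :
  mx2 x y z t *m mx2 x' y' z' t' =
  mx2 (x * x' + y * z') (x * y' + y * t') (z * x' + t * z') (z * y' + t * t').
Proof.
apply/matrixP=> i j; rewrite !mxE !big_ord_recl big_ord0 addr0 !mxE.
by case: i => -[|[|//]] ?; case: j => -[|[|//]] ?.
Qed.

Lemma mx2_1 : mx2 1 0 0 1 = 1%:M.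
Proof.
apply/matrixP=> i j; rewrite !mxE.
by case: i => -[|[|//]] ?; case: j => -[|[|//]] ?.
Qed.

Lemma matAA : matA *m matA = 1%:M.
Proof. by rewrite mx2_mul -mx2_1. Qed.

Lemma matA_unit : matA \in unitmx.
Proof. by have [] := mulmx1_unit matAA. Qed.

Lemma matB_unit k : matB k \in unitmx.
Proof.
suff /mulmx1_unit[] : matB k *m mx2 k (-1) 1 0 = 1%:M by [].
by rewrite mx2_mul -mx2_1 !(mul0r, mul1r, mulN1r, mulr1, mulr0, add0r, addr0)
  addNr opprK.
Qed.

Definition GL2Z_A : GL2Z := MkGL2Z matA_unit.
Definition GL2Z_B (k : int) : GL2Z := MkGL2Z (matB_unit k).

Definition gen2_act (k : int) (g : gen2) : GL2Z :=
  match g with gen_a => GL2Z_A | gen_b => GL2Z_B k end.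

Lemma gen2_act_relator k r :
  relators_G2 r -> eval_word (gen2_act k) r = 1%g.
Proof.
move=> ->; rewrite /eval_word !big_cons big_nil /= mulg1.
have -> : (GL2Z_A^-1 = GL2Z_A)%g.
  by apply: (mulgI GL2Z_A); rewrite mulgV; apply/val_inj/esym/matAA.
apply/val_inj => /=; rewrite !mx2_mul -mx2_1.
rewrite !(mul0r, mul1r, mulN1r, mulr1, mulr0, add0r, addr0, mulrN1).
by rewrite opprK addNr.
Qed.

Definition G2_act (k : int) : G2 -> GL2Z :=
  pres_lift (@gen2_act_relator k).
HB.instance Definition _ k := UMagmaMorphism.on (G2_act k).

Lemma G2_act_a k : G2_act k G2_a = GL2Z_A.
Proof. exact: pres_lift_gen. Qed.

Lemma G2_act_b k : G2_act k G2_b = GL2Z_B k.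
Proof. exact: pres_lift_gen. Qed.

End GL2Z.

(* The pair (v, g) stands for the product v g, so that g acts on Z^2 by
   g v g^-1 = (G2_act k g) *m v. *)
Definition H (k : int) : Type := ('cV[int]_2 * G2)%type.

Section SemidirectProduct.
Variable k : int.

HB.instance Definition _ := Choice.on (H k).

Definition H_one : H k := (0%R, 1).
Definition H_mul (x y : H k) : H k :=
  ((x.1 + GL2Z_mx (G2_act k x.2) *m y.1)%R, x.2 * y.2).
Definition H_inv (x : H k) : H k :=
  ((- (GL2Z_mx (G2_act k x.2^-1) *m x.1))%R, x.2^-1).

Lemma G2_act1 : GL2Z_mx (G2_act k 1) = 1%:M%R.
Proof. by rewrite gmulf1. Qed.
Lemma G2_actM g h :
  GL2Z_mx (G2_act k (g * h)) = (GL2Z_mx (G2_act k g) *m GL2Z_mx (G2_act k h))%R.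
Proof. by rewrite gmulfM. Qed.

Lemma H_mulA : associative H_mul.
Proof.
move=> x y z; rewrite /H_mul /= mulgA G2_actM mulmxDr mulmxA.
by rewrite addrA.
Qed.
Lemma H_mul1 : left_id H_one H_mul.
Proof. by case=> v g; rewrite /H_mul /= G2_act1 mul1mx add0r mul1g. Qed.
Lemma H_mulr1 : right_id H_one H_mul.
Proof. by case=> v g; rewrite /H_mul /= mulmx0 addr0 mulg1. Qed.
Lemma H_mulV : left_inverse H_one H_inv H_mul.
Proof. by case=> v g; rewrite /H_mul /H_inv /= addNr mulVg. Qed.
Lemma H_mulrV : right_inverse H_one H_inv H_mul.
Proof.
case=> v g; rewrite /H_mul /H_inv /= mulmxN mulmxA -G2_actM mulgV.
by rewrite G2_act1 mul1mx addrN.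
Qed.

HB.instance Definition _ := isGroup.Build (H k)
  H_mulA H_mul1 H_mulr1 H_mulV H_mulrV.

End SemidirectProduct.

(* Main.v *)
(* A maximal subgroup M of finite index is the kernel of a crossed homomorphism
   delta from H_k onto a simple module W over F_p, so its index is #|W|, that is
   p or p^2.  Which W occur depends on the first term A of the normal series
   Z^2 < Z^2 <b> < H_k not contained in M: the image of A is A / (A :&: M), a
   simple module on which A acts trivially, and M supplements A.  When A is H_k
   or Z^2 <b>, W is F_p and for every p there are 1 and p possibilities, the
   p + 1 maximal subgroups of index p in G_2.  When A is Z^2, W is a simple
   quotient of F_p^2: the plane itself if p does not divide (k-2)(k+2), and then
   delta is inner, v g |-> v + g w - w; otherwise its quotient by the common
   eigenvector (1, 1) (if p | k-2, where delta a and delta b are arbitrary) or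
   (1, -1) (if p | k+2 and p > 2, where delta is determined by delta b). *)
From HB Require Import structures.
Require Import Defs.
From mathcomp Require Import all_boot all_order all_algebra.
From mathcomp Require Import boolp classical_sets functions cardinality.
From mathcomp Require Import ring zify.

Set Implicit Arguments.
Unset Strict Implicit.
Unset Printing Implicit Defensive.

Import Order.TTheory GRing.Theory Num.Theory.

Local Open Scope classical_set_scope.
Local Open Scope card_scope.
Local Open Scope group_scope.

(** * Maximal subgroups and crossed homomorphisms *)

(** No crossed homomorphism is constructed from [M]. Each candidate is given by a formula, and [M]
    is recognised as its kernel: two subgroups with the same trace on A coincide as soon as their
    intersection supplements A ([supplement_eq]), and supplementing has to be tested on generators
    only. The trace itself comes from maximality and finite index. The number of candidates is
    governed by the relation b a b = a, which for x = delta a and y = delta b reads y + b x + b a y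
    = x in W. If p | k-2, then b acts as 1 and a as -1, and every pair (x, y) is a solution. If p |
    k+2, then b acts as -1 and a as 1, which leaves 2x = 0. On the irreducible plane the relation
    determines x from y. Distinct solutions have distinct kernels because delta is normalised on A.
    For p = 2 the first two situations coincide, hence the bound p > 2 in the second. *)

Section Subgroups.
Variable G : groupType.
Implicit Types (M K : set G) (x y : G).

Lemma is_subgroupI M :
    M 1 -> (forall x y, M x -> M y -> M (x * y)) ->
    (forall x, M x -> M x^-1) ->
  is_subgroup M.
Proof.
move=> M1 MM MV; split=> [|x y]; rewrite ?inE // => Mx My.
exact/MM/MV.
Qed.

Lemma is_subgroup1 M : is_subgroup M -> M 1.
Proof. by case; rewrite inE. Qed.

Lemma is_subgroupV M x : is_subgroup M -> M x -> M x^-1.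
Proof.
move=> sM Mx; have /(_ x) := group_closedV sM.
by rewrite !inE; exact.
Qed.

Lemma is_subgroupM M x y : is_subgroup M -> M x -> M y -> M (x * y).
Proof.
move=> sM Mx My; have /(_ x y) := group_closedM sM.
by rewrite !inE; exact.
Qed.

Lemma is_subgroup_mulr M x y :
  is_subgroup M -> M x -> M (x * y) <-> M y.
Proof.
move=> sM Mx; split=> [Mxy|]; last exact: is_subgroupM.
by rewrite -(mulKg x y); apply: is_subgroupM => //; exact: is_subgroupV.
Qed.

Lemma is_subgroup_mull M x y :
  is_subgroup M -> M y -> M (x * y) <-> M x.
Proof.
move=> sM My; split=> [Mxy|Mx]; last exact: is_subgroupM.
by rewrite -(mulgK y x); apply: is_subgroupM => //; exact: is_subgroupV.
Qed.

Lemma is_subgroupX M x m : is_subgroup M -> M x -> M (x ^+ m).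
Proof.
move=> sM Mx; elim: m => [|m IH]; first exact: is_subgroup1.
by rewrite expgS; exact: is_subgroupM.
Qed.

Lemma is_subgroupI2 M K : is_subgroup M -> is_subgroup K -> is_subgroup (M `&` K).
Proof.
move=> sM sK; apply: is_subgroupI => [|x y [? ?] [? ?]|x [? ?]].
- by split; exact: is_subgroup1.
- by split; exact: is_subgroupM.
- by split; exact: is_subgroupV.
Qed.

Lemma left_coset_eq M x y : is_subgroup M ->
  [set x * z | z in M] = [set y * z | z in M] <-> M (x^-1 * y).
Proof.
move=> sM; split=> [exy|Mxy].
  have : [set y * z | z in M] y by exists 1; [exact: is_subgroup1|rewrite mulg1].
  by rewrite -exy => -[z Mz <-]; rewrite mulKg.
apply/seteqP; split=> _ [z Mz <-].
  exists ((x^-1 * y)^-1 * z); last by rewrite invgM invgK !mulgA mulgV mul1g.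
  by apply: is_subgroupM => //; exact: is_subgroupV.
exists (x^-1 * y * z); last by rewrite !mulgA mulgV mul1g.
exact: is_subgroupM.
Qed.

End Subgroups.

Lemma card_range_finType (T : finType) U (f : T -> U) :
  injective f -> range f #= `I_#|T|.
Proof.
move=> f_inj; apply: (@card_eq_trans _ _ _ _ [set: T]).
  by apply: inj_card_eq => x y _ _; exact: f_inj.
rewrite card_eq_sym; apply: (card_eq_trans card_II).
have -> : [set: T] = range (@enum_val T predT).
  by apply/seteqP; split=> // x _; exists (enum_rank x); rewrite // enum_rankK.
by rewrite card_eq_sym; apply: inj_card_eq => x y _ _; exact: enum_val_inj.
Qed.

Lemma has_index_inj (G : groupType) (M : set G) m n :
  has_index M m -> has_index M n -> m = n.
Proof.
move=> Mm Mn; apply/card_eq_II; apply: card_eq_trans Mn.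
by rewrite card_eq_sym.
Qed.

(** Otherwise the cosets of the powers of [x] would be pairwise distinct, against finite index. *)
Lemma has_index_expg (G : groupType) (M : set G) n (x : G) :
  is_subgroup M -> has_index M n -> exists2 m, (0 < m)%N & M (x ^+ m).
Proof.
move=> sM Mn; apply: contrapT => noM; apply: infinite_nat.
pose f m := [set x ^+ m * z | z in M].
have f_inj : injective f.
  suff f_lt i j : (i < j)%N -> f i <> f j.
    by move=> i j eqf; case: (ltngtP i j) => // /f_lt; rewrite eqf.
  move=> lt_ij /(left_coset_eq _ _ sM); rewrite -(subnKC (ltnW lt_ij)) expgnDr.
  by rewrite mulKg => Mx; apply: noM; exists (j - i)%N; rewrite ?subn_gt0.
have /eq_finite_set <- : range f #= [set: nat].
  by apply: inj_card_eq => i j _ _; exact: f_inj.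
apply: (@sub_finite_set _ _ (left_cosets M)); last by apply/finite_setP; exists n.
by move=> _ [m _ <-]; exists (x ^+ m).
Qed.

Section Derivation.
Variables (G : groupType) (W : finZmodType) (rho : G -> W -> W).
Variables (delta : G -> W) (s : W -> G).
Hypothesis rhoD : forall g u v, rho g (u + v)%R = (rho g u + rho g v)%R.
Hypothesis rho1 : forall u, rho 1 u = u.
Hypothesis rhoM : forall g h u, rho (g * h) u = rho g (rho h u).
Hypothesis deltaM : forall g h, delta (g * h) = (delta g + rho g (delta h))%R.

Definition derivation_ker : set G := [set g | delta g = 0%R].

Lemma delta1 : delta 1 = 0%R.
Proof.
have := deltaM 1 1; rewrite mulg1 rho1 => /eqP.
by rewrite -subr_eq0 opprD addNKr oppr_eq0 => /eqP.
Qed.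

Lemma rho0 g : rho g 0%R = 0%R.
Proof.
have := rhoD g 0%R 0%R; rewrite addr0 => /eqP.
by rewrite -subr_eq0 opprD addNKr oppr_eq0 => /eqP.
Qed.

Lemma rho_inj g : injective (rho g).
Proof. by move=> u v euv; rewrite -(rho1 u) -(rho1 v) -(mulVg g) !rhoM euv. Qed.

Lemma deltaV g : delta g^-1 = (- rho g^-1 (delta g))%R.
Proof. by apply/eqP; rewrite -addr_eq0 -deltaM mulVg delta1. Qed.

(** Since delta (g^-1 h) = rho g^-1 (delta h - delta g) and rho g^-1 is injective, delta labels the
    left cosets of its kernel by elements of [W]. *)
Lemma derivation_ker_coset g h : delta g = delta h <-> derivation_ker (g^-1 * h).
Proof.
rewrite /derivation_ker /= deltaM deltaV addrC; split=> [->|/eqP].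
  by rewrite subrr.
by rewrite subr_eq0 => /eqP /rho_inj.
Qed.

Lemma derivation_ker_subgroup : is_subgroup derivation_ker.
Proof.
apply: is_subgroupI => [|x y /= dx dy|x /= dx]; rewrite /derivation_ker /=.
- exact: delta1.
- by rewrite deltaM dx dy rho0 addr0.
- by rewrite deltaV dx rho0 oppr0.
Qed.

Hypothesis sK : cancel s delta.

Lemma derivation_ker_index : has_index derivation_ker #|W|.
Proof.
pose f w := [set s w * z | z in derivation_ker].
have f_inj : injective f.
  move=> u v /(left_coset_eq _ _ derivation_ker_subgroup) /derivation_ker_coset.
  by rewrite !sK.
rewrite /has_index; suff -> : left_cosets derivation_ker = range f.
  exact: card_range_finType.
apply/seteqP; split=> _ [x _ <-]; last by exists (s x).
exists (delta x) => //; apply/left_coset_eq; first exact: derivation_ker_subgroup.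
by apply/derivation_ker_coset; rewrite sK.
Qed.

Hypothesis rho_s : forall w u, rho (s w) u = u.
Hypothesis W_neq0 : exists w : W, w <> 0%R.
Hypothesis W_simple : forall S : set W, S 0%R ->
  (forall u v, S u -> S v -> S (u + v)%R) ->
  (forall g u, S u -> S (rho g u)) ->
  (exists2 u, S u & u <> 0%R) -> forall u, S u.

(** A subgroup [K] above the kernel is a union of its cosets, so it is determined by the set of [w]
    with [K (s w)]. As [s w] acts trivially on [W], delta is additive on the image of [s], and this
    set is a submodule, to which simplicity applies. *)
Lemma derivation_ker_maximal : is_maximal_subgroup derivation_ker.
Proof.
have sM := derivation_ker_subgroup.
split=> // [kerT|K sK' MK].
  have [w w0] := W_neq0; apply: w0.
  by rewrite -(sK w); suff : derivation_ker (s w) by []; rewrite kerT.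
have [KM|/existsNP[h /not_implyP[Kh Mh]]] := pselect (K `<=` derivation_ker).
  by left; apply/seteqP.
right; have Ks x : K (s (delta x)) <-> K x.
  have Mx : derivation_ker ((s (delta x))^-1 * x).
    by apply/derivation_ker_coset; rewrite sK.
  by rewrite -{2}(mulVKg (s (delta x)) x); apply: iff_sym; apply/is_subgroup_mull/MK.
apply/seteqP; split=> // x _; apply/Ks.
apply: (W_simple (S := [set w | K (s w)])) => [|u v /= Ku Kv|g u /= Ku|].
- by apply: MK; exact: sK.
- have -> : (u + v)%R = delta (s u * s v) by rewrite deltaM !sK rho_s.
  by apply/Ks; exact: is_subgroupM.
(* [g] need not lie in [K]. Dividing it by [s (delta g)], which acts trivially, gives an element of
   the kernel with the same action, and conjugation by that element stays in [K]. *)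
- have [m [Mm ->]] : exists m, derivation_ker m /\ rho g u = rho m u.
    exists ((s (delta g))^-1 * g); split.
      by apply/derivation_ker_coset; rewrite sK.
    by rewrite rhoM -{2}(rho_s (delta g) (rho g u)) -rhoM mulVg rho1.
  have -> : rho m u = delta (m * s u * m^-1).
    by rewrite !deltaM deltaV Mm rho0 oppr0 rho0 addr0 add0r sK.
  apply/Ks; apply: is_subgroupM (is_subgroupV sK' (MK _ Mm)) => //.
  by apply: is_subgroupM => //; exact: MK.
- by exists (delta h); [exact/Ks|].
Qed.

End Derivation.

(* Modulo P, iota embeds V as a normal abelian subgroup on which g acts by
   rho g; in H_k, V is Z^2, <b> or <a>, and P is the previous term of the series
   1 < Z^2 < Z^2 <b> < H_k. *)
Section Supplement.
Variables (G : groupType) (V : zmodType) (iota : V -> G) (rho : G -> V -> V).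
Variable P : set G.
Hypothesis iota0 : iota 0%R = 1.
Hypothesis iotaD : forall u v, iota (u + v)%R = iota u * iota v.
Hypothesis rhoD : forall g u v, rho g (u + v)%R = (rho g u + rho g v)%R.
Hypothesis iota_comm : forall g u v,
  P (iota u * g * iota v * (iota (u + rho g v)%R * g)^-1).

Definition rho_stable (K : set V) :=
  [/\ K 0%R, forall u v, K u -> K v -> K (u + v)%R,
      forall u, K u -> K (- u)%R & forall g u, K u -> K (rho g u)].

(** For [K] closed under negation this is the product set of iota(K) and [Q]. *)
Definition prodV (K : set V) (Q : set G) : set G :=
  [set g | exists2 v, K v & Q (iota v * g)].

Lemma rho_stableT : rho_stable setT.
Proof. by []. Qed.

Lemma iotaN v : iota (- v)%R = (iota v)^-1.
Proof. by apply: (mulIg (iota v)); rewrite -iotaD addNr iota0 mulVg. Qed.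

Lemma iotaMn v m : iota (v *+ m)%R = iota v ^+ m.
Proof. by elim: m => [|m IH]; rewrite ?mulr0n // mulrS iotaD expgS IH. Qed.

Lemma stable_rho0 g : rho g 0%R = 0%R.
Proof.
have := rhoD g 0%R 0%R; rewrite addr0 => /eqP.
by rewrite -subr_eq0 opprD addNKr oppr_eq0 => /eqP.
Qed.

Lemma rhoMn g v m : rho g (v *+ m)%R = (rho g v *+ m)%R.
Proof. by elim: m => [|m IH]; rewrite ?mulr0n ?stable_rho0 // !mulrS rhoD IH. Qed.

Section Subgroup.
Variable Q : set G.
Hypotheses (sQ : is_subgroup Q) (PQ : P `<=` Q).

(** The discrepancy in [iota_comm] lies in [P], hence in [Q], so membership in [Q] does not see
    it. *)
Lemma iota_commQ g h u v :
  Q (iota u * g * (iota v * h)) <-> Q (iota (u + rho g v)%R * (g * h)).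
Proof.
rewrite -[X in _ <-> X](is_subgroup_mulr _ sQ (PQ (iota_comm g u v))).
by rewrite (mulgA _ g h) -(mulgA _ _^-1) mulKg !mulgA.
Qed.

Lemma prodV_subgroup K : rho_stable K -> is_subgroup (prodV K Q).
Proof.
move=> [K0 KD KN Krho]; apply: is_subgroupI.
- by exists 0%R; rewrite // iota0 mulg1; exact: is_subgroup1.
- move=> g h [u Ku Qu] [v Kv Qv].
  exists (u + rho g v)%R; first by apply: KD => //; exact: Krho.
  by apply/iota_commQ; exact: is_subgroupM.
- move=> g [v Kv Qv]; exists (- rho g^-1 v)%R; first exact/KN/Krho.
  apply/(is_subgroup_mull _ sQ Qv)/iota_commQ.
  by rewrite addNr mulVg iota0 mulg1; exact: is_subgroup1.
Qed.

Lemma sub_prodV K : rho_stable K -> Q `<=` prodV K Q.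
Proof. by move=> [K0 _ _ _] x Qx; exists 0%R; rewrite // iota0 mul1g. Qed.

Lemma prodV_iota K v : rho_stable K -> K v -> prodV K Q (iota v).
Proof.
move=> [_ _ KN _] Kv; exists (- v)%R; first exact: KN.
by rewrite iotaN mulVg; exact: is_subgroup1.
Qed.
End Subgroup.

(** Dedekind's modular law: for [g] in [M1], some [iota v * g] lies in both subgroups; then [iota v]
    lies in [M1], hence in [M2], and so does [g]. *)
Lemma supplement_eq (M1 M2 : set G) :
    is_subgroup M1 -> is_subgroup M2 ->
    (forall v, M1 (iota v) <-> M2 (iota v)) ->
  prodV setT (M1 `&` M2) = setT -> M1 = M2.
Proof.
move=> sM1 sM2 eqM prodT; apply/seteqP; split=> g Mg.
  have [v _ [M1v M2v]] : prodV setT (M1 `&` M2) g by rewrite prodT.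
  have /eqM M2iv : M1 (iota v) by exact/(is_subgroup_mull _ sM1 Mg).
  exact/(is_subgroup_mulr _ sM2 M2iv).
have [v _ [M1v M2v]] : prodV setT (M1 `&` M2) g by rewrite prodT.
have /eqM M1iv : M2 (iota v) by exact/(is_subgroup_mull _ sM2 Mg).
exact/(is_subgroup_mulr _ sM1 M1iv).
Qed.

Section Maximal.
Variable M : set G.
Hypotheses (maxM : is_maximal_subgroup M) (PM : P `<=` M).

Let sM : is_subgroup M. Proof. by case: maxM. Qed.
Let L : set V := [set v | M (iota v)].

(** Maximality is applied to the product of iota(K) and [M], a subgroup lying between [M] and
    [G]. *)
Lemma prodV_maximal K : rho_stable K -> K `<=` L \/ prodV K M = setT.
Proof.
move=> stK; have [_ _ /(_ (prodV K M))] := maxM.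
move=> /(_ (prodV_subgroup sM PM stK) (sub_prodV stK)) [eqM|]; last by right.
by left=> v Kv; rewrite /L /= -eqM; exact: prodV_iota.
Qed.

Hypothesis LT : exists v, ~ L v.

Lemma prodV_setT : prodV setT M = setT.
Proof. by have [v Lv] := LT; have [/(_ v I)|] := prodV_maximal rho_stableT. Qed.

Lemma iota_supplement g : exists v, M (iota v * g).
Proof.
have : prodV setT M g by rewrite prodV_setT.
by case=> v; exists v.
Qed.

Lemma trace_stable : rho_stable L.
Proof.
split=> [|u v Lu Lv|u Lu|g v Lv].
- by rewrite /L /= iota0; exact: is_subgroup1.
- by rewrite /L /= iotaD; exact: is_subgroupM.
- by rewrite /L /= iotaN; exact: is_subgroupV.
(* [g] is replaced by [iota w * g] in [M]; the extra factor does not change the action, because the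
   image of iota is abelian. *)
- have [w Mw] := iota_supplement g.
  have : M (iota w * g * (iota v * 1)) by rewrite mulg1; exact: is_subgroupM.
  rewrite (iota_commQ sM PM) mulg1 addrC iotaD -mulgA.
  by move/(is_subgroup_mull _ sM Mw).
Qed.

(** This is the simplicity of the module V / L. *)
Lemma trace_maximal K : rho_stable K ->
  K `<=` L \/ forall u, exists2 v, K v & L (v + u)%R.
Proof.
move=> /prodV_maximal[|prodT]; [by left|right=> u].
have [v Kv Mv] : prodV K M (iota u) by rewrite prodT.
by exists v; rewrite // /L /= iotaD.
Qed.

(** Descent on m = p q with p = [pdiv m]. If qV lies in L, then q replaces m. Otherwise V = qV + L
    by simplicity, and multiplication by p sends the right-hand side into mV + L = L. *)
Lemma trace_prime m : (0 < m)%N -> (forall v, L (v *+ m)%R) ->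
  exists2 p, prime p & forall v, L (v *+ p)%R.
Proof.
have [L0 LD LN Lrho] := trace_stable.
have [m'] := ubnP m; elim: m' m => // m' IH m lt_mm' m_gt0 Lm.
have m_neq1 : m != 1%N.
  by apply/eqP=> m1; have [v []] := LT; rewrite -[v]mulr1n -m1.
have [p_pr /dvdnP[q def_m]] := (@pdiv_prime m, pdiv_dvd m).
have {}p_pr : prime (pdiv m) by apply: p_pr; rewrite ltn_neqAle eq_sym m_neq1.
have q_gt0 : (0 < q)%N by move: m_gt0; rewrite def_m muln_gt0 => /andP[].
pose K := range (fun v : V => (v *+ q)%R).
have stK : rho_stable K.
  split=> [|_ _ [u _ <-] [v _ <-]|_ [u _ <-]|g _ [u _ <-]].
  - by exists 0%R; rewrite // mul0rn.
  - by exists (u + v)%R; rewrite // mulrnDl.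
  - by exists (- u)%R; rewrite // mulNrn.
  - by exists (rho g u); rewrite // rhoMn.
have [KL|LK] := trace_maximal stK.
  apply: (IH q) => // [|v]; last by apply: KL; exists v.
  rewrite -ltnS; apply: leq_trans lt_mm'; rewrite ltnS def_m.
  by rewrite ltn_Pmulr // prime_gt1.
exists (pdiv m) => // u; have [_ [v _ <-] Lvu] := LK u.
have LMn w j : L w -> L (w *+ j)%R.
  move=> Lw; elim: j => [|j IHj]; first by rewrite mulr0n.
  by rewrite mulrS; exact: LD.
have -> : (u *+ pdiv m = (v *+ q + u) *+ pdiv m - v *+ m)%R.
  by rewrite {3}def_m mulrnA mulrnDl addrC addKr.
by apply: LD; [exact: LMn|exact: LN].
Qed.

End Maximal.

End Supplement.

(** * The Klein bottle group *)

Section IntegerPowers.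
Variable G : groupType.
Implicit Types (x y : G) (m n : int).

Definition expgz x m := match m with Posz n => x ^+ n | Negz n => x ^- n.+1 end.

Lemma expgzSr x m : expgz x (m + 1)%R = expgz x m * x.
Proof.
case: m => [n|[|n]]; first by rewrite -PoszD addn1 /= expgSr.
  by rewrite /= expg1 mulVg.
have -> : (Negz n.+1 + 1)%R = Negz n by rewrite !NegzE; lia.
by rewrite /= [x ^+ n.+2]expgS invgM mulgVK.
Qed.

Lemma expgzD x m n : expgz x (m + n)%R = expgz x m * expgz x n.
Proof.
elim/int_rect: n => [|n IH|n IH]; first by rewrite addr0 mulg1.
  by rewrite -addn1 PoszD addrA !expgzSr IH mulgA.
apply: (mulIg x); rewrite -mulgA -!expgzSr.
have e : (- n.+1%:Z + 1 = - n%:Z)%R by lia.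
by rewrite -addrA e.
Qed.

Lemma expgz0 x : expgz x 0%R = 1. Proof. by []. Qed.

Lemma expgz1 x : expgz x 1%R = x. Proof. by []. Qed.

Lemma expgzN x m : expgz x (- m)%R = (expgz x m)^-1.
Proof. by apply: (mulIg (expgz x m)); rewrite -expgzD addNr mulVg. Qed.

Lemma expgz_intertwine g x y m : g * x = y * g -> g * expgz x m = expgz y m * g.
Proof.
move=> gxy; elim/int_rect: m => [|n IH|n IH]; first by rewrite mulg1 mul1g.
  by rewrite -addn1 PoszD !expgzSr mulgA IH -!mulgA gxy.
apply: (mulIg x); rewrite -[LHS]mulgA -[RHS]mulgA gxy !mulgA -mulgA -!expgzSr.
have -> : (- n.+1%:Z + 1 = - n%:Z)%R by lia.
by [].
Qed.

Lemma expgzVn x m : expgz x^-1 m = expgz x (- m)%R.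
Proof.
elim/int_rect: m => [|n IH|n IH] //.
  by rewrite -addn1 PoszD opprD expgzSr IH !expgzD.
by apply: (mulIg x^-1); rewrite -expgzSr -(expgzN x 1%R) -expgzD -addn1 PoszD
  !opprD !opprK addrNK IH opprK addrK.
Qed.

End IntegerPowers.

Arguments expgz {G} x m : simpl never.

Definition sg (j : int) : int := ((-1) ^ j)%R.

Lemma sgD i j : sg (i + j)%R = (sg i * sg j)%R.
Proof. by rewrite /sg exprzDr. Qed.

Lemma sg_sqr j : (sg j * sg j = 1)%R.
Proof. by rewrite /sg -exprzMl // mulrNN mulr1 exp1rz. Qed.

Lemma sgN j : sg (- j)%R = sg j.
Proof.
rewrite -[LHS]mulr1 -(sg_sqr j) mulrA -sgD addNr.
by rewrite /sg expr0z mul1r.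
Qed.

(** A concrete model of G_2 in which (i, j) stands for b^i a^j. A morphism from the presented group
    to it turns the exponents of b and a into well-defined functions on G_2. *)
Definition Klein : Type := (int * int)%type.
HB.instance Definition _ := Choice.on Klein.

Section Klein.
Local Open Scope ring_scope.
Implicit Types x y z : Klein.

Definition Klein_one : Klein := (0, 0).
Definition Klein_mul x y : Klein := (x.1 + sg x.2 * y.1, x.2 + y.2).
Definition Klein_inv x : Klein := (- (sg x.2 * x.1), - x.2).

Lemma Klein_mulA : associative Klein_mul.
Proof. by move=> x y z; rewrite /Klein_mul /= sgD; congr pair; ring. Qed.
Lemma Klein_mul1 : left_id Klein_one Klein_mul.
Proof. by case=> i j; rewrite /Klein_mul /= mul1r !add0r. Qed.
Lemma Klein_mulr1 : right_id Klein_one Klein_mul.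
Proof. by case=> i j; rewrite /Klein_mul /= mulr0 !addr0. Qed.
Lemma Klein_mulV : left_inverse Klein_one Klein_inv Klein_mul.
Proof. by case=> i j; rewrite /Klein_mul /Klein_inv /= sgN !addNr. Qed.
Lemma Klein_mulrV : right_inverse Klein_one Klein_inv Klein_mul.
Proof.
by case=> i j; rewrite /Klein_mul /Klein_inv /= mulrN mulrA sg_sqr mul1r !addrN.
Qed.

HB.instance Definition _ := isGroup.Build Klein
  Klein_mulA Klein_mul1 Klein_mulr1 Klein_mulV Klein_mulrV.

Definition gen2_Klein (g : gen2) : Klein :=
  match g with gen_a => (0, 1) | gen_b => (1, 0) end.

Lemma gen2_Klein_relator r : relators_G2 r -> eval_word gen2_Klein r = 1%g.
Proof. by move=> ->; rewrite /eval_word !big_cons big_nil. Qed.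

Definition G2_Klein : G2 -> Klein := pres_lift gen2_Klein_relator.
HB.instance Definition _ := UMagmaMorphism.on G2_Klein.

Definition expb (g : G2) : int := (G2_Klein g).1.
Definition expa (g : G2) : int := (G2_Klein g).2.

Lemma expbM g h : expb (g * h)%g = expb g + sg (expa g) * expb h.
Proof. by rewrite /expb gmulfM. Qed.
Lemma expaM g h : expa (g * h)%g = expa g + expa h.
Proof. by rewrite /expa gmulfM. Qed.
Lemma expb1 : expb 1%g = 0. Proof. by rewrite /expb gmulf1. Qed.
Lemma expa1 : expa 1%g = 0. Proof. by rewrite /expa gmulf1. Qed.
Lemma expaV g : expa g^-1%g = - expa g.
Proof. by apply/eqP; rewrite -addr_eq0 -expaM mulVg expa1. Qed.
Lemma G2_Klein_a : G2_Klein G2_a = (0, 1). Proof. exact: pres_lift_gen. Qed.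
Lemma G2_Klein_b : G2_Klein G2_b = (1, 0). Proof. exact: pres_lift_gen. Qed.
Lemma expb_a : expb G2_a = 0. Proof. by rewrite /expb G2_Klein_a. Qed.
Lemma expa_a : expa G2_a = 1. Proof. by rewrite /expa G2_Klein_a. Qed.
Lemma expb_b : expb G2_b = 1. Proof. by rewrite /expb G2_Klein_b. Qed.
Lemma expa_b : expa G2_b = 0. Proof. by rewrite /expa G2_Klein_b. Qed.

Lemma expa_expgz g m : expa (expgz g m) = m * expa g.
Proof.
elim/int_rect: m => [|n IH|n IH]; first by rewrite expa1 mul0r.
  by rewrite -addn1 PoszD expgzSr expaM IH mulrDl mul1r.
by rewrite -addn1 PoszD opprD expgzD expaM IH expgzN expgz1 expaV; ring.
Qed.

Lemma expb_expgz m : expb (expgz G2_b m) = m.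
Proof.
have s0 : sg 0 = 1 by rewrite /sg expr0z.
elim/int_rect: m => [|n IH|n IH]; first by rewrite expb1.
  by rewrite -addn1 PoszD expgzSr expbM IH expa_expgz expa_b expb_b mulr0 s0.
have := expbM (expgz G2_b (- n.+1%:Z)) G2_b.
rewrite -expgzSr expa_expgz expa_b expb_b mulr0 s0 mulr1.
have -> : - n.+1%:Z + 1 = - n%:Z by lia.
by rewrite IH => ?; lia.
Qed.

End Klein.

Lemma pres_class_cat (T : choiceType) (R : set (word T)) (w1 w2 : word T) :
  pres_class R (w1 ++ w2) = pres_class R w1 * pres_class R w2.
Proof. exact/esym/pres_mulE. Qed.

Lemma pres_gen_inv (T : choiceType) (R : set (word T)) (x : T) :
  pres_class R [:: (x, true)] = (pres_gen R x)^-1.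
Proof.
apply: (mulIg (pres_gen R x)); rewrite mulVg -pres_class_cat.
exact/presP/(pres_cancel R x true).
Qed.

Lemma G2_gen (Q : set G2) : is_subgroup Q -> Q G2_a -> Q G2_b -> forall g, Q g.
Proof.
move=> sQ Qa Qb g; rewrite -(pres_classK g).
elim: (repr g) => [|[x e] w IH]; first exact: (is_subgroup1 sQ).
rewrite (pres_class_cat _ [:: (x, e)]); apply: (is_subgroupM sQ _ IH).
have Qx : Q (pres_gen relators_G2 x) by case: x.
by case: e => //; rewrite pres_gen_inv; exact: (is_subgroupV sQ).
Qed.

Lemma G2_relator : G2_a * G2_b * G2_a^-1 * G2_b = 1.
Proof.
pose r := [:: (gen_a, false); (gen_b, false); (gen_a, true); (gen_b, false)].
transitivity (pres_class relators_G2 r); last exact/presP/(@pres_relator _ _ r).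
rewrite (pres_class_cat _ [:: (gen_a, false); (gen_b, false); (gen_a, true)]).
rewrite (pres_class_cat _ [:: (gen_a, false); (gen_b, false)]).
by rewrite (pres_class_cat _ [:: (gen_a, false)]) pres_gen_inv.
Qed.

Lemma G2_ab : G2_a * G2_b = G2_b^-1 * G2_a.
Proof.
apply: (mulIg G2_a^-1); rewrite mulgK; apply: (mulIg G2_b).
by rewrite mulVg G2_relator.
Qed.

Lemma G2_expgz_comm g m :
  g * expgz G2_b m = expgz G2_b (sg (expa g) * m)%R * g.
Proof.
pose Q := [set g : G2 | forall m,
  g * expgz G2_b m = expgz G2_b (sg (expa g) * m)%R * g].
suff Qg : Q g by exact: Qg.
apply: G2_gen => {g m}.
- apply: is_subgroupI => [m|g h Qg Qh m|g Qg m].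
  + by rewrite mul1g mulg1 expa1 /sg expr0z mul1r.
  + by rewrite -mulgA Qh mulgA Qg expaM sgD -!mulgA -mulrA.
  + apply: (mulgI g); rewrite mulVKg mulgA Qg expaV sgN mulrA sg_sqr mul1r.
    by rewrite mulgK.
- move=> m; rewrite expa_a -[sg 1]/(-1)%R mulN1r -expgzVn.
  exact/expgz_intertwine/G2_ab.
- move=> m; rewrite expa_b -[sg 0]/1%R mul1r -{1 4}[G2_b]expgz1.
  by rewrite -!expgzD addrC.
Qed.

Lemma G2_normal_form g : exists m, g = expgz G2_b m * expgz G2_a (expa g).
Proof.
pose Q := [set g | exists m, g = expgz G2_b m * expgz G2_a (expa g)].
suff : Q g by []; apply: G2_gen => {g}.
- apply: is_subgroupI.
  + by exists 0%R; rewrite expa1 mul1g.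
  + move=> g h [m gE] [n hE]; exists (m + sg (expa (expgz G2_a (expa g))) * n)%R.
    rewrite [in LHS]gE [in LHS]hE expaM !expgzD -!mulgA; congr (_ * _).
    by rewrite !mulgA G2_expgz_comm.
  + move=> g [m gE]; exists (sg (expa (expgz G2_a (- expa g)%R)) * - m)%R.
    by rewrite [in LHS]gE invgM -!expgzN G2_expgz_comm expaV.
- by exists 0%R; rewrite expa_a mul1g.
- by exists 1%R; rewrite expa_b mulg1.
Qed.

Local Close Scope group_scope.
Local Open Scope ring_scope.

(** * Signs, parity and coordinates in the plane *)

Lemma sg_cases j : sg j = 1 \/ sg j = -1.
Proof.
have /eqP := sg_sqr j; rewrite -expr2 sqrf_eq1 => /orP[] /eqP ->; by [left|right].
Qed.

Lemma sgM i j : sg (sg i * j) = sg j.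
Proof. by case: (sg_cases i) => ->; rewrite ?mul1r ?mulN1r ?sgN. Qed.

Lemma sg0 : sg 0 = 1. Proof. by rewrite /sg expr0z. Qed.
Lemma sg1 : sg 1 = -1. Proof. by []. Qed.

(** The crossed homomorphism on Z, for the action by [sg], with value 1 at 1; for j >= 0 it is the
    alternating sum 1 - 1 + 1 - ... with j terms. *)
Definition parity (j : int) : int := if sg j == 1 then 0 else 1.

Lemma parityD i j : parity (i + j) = parity i + sg i * parity j.
Proof. by rewrite /parity sgD; case: (sg_cases i) => ->; case: (sg_cases j) => ->. Qed.

Lemma parity0 : parity 0 = 0. Proof. by rewrite /parity sg0. Qed.
Lemma parity1 : parity 1 = 1. Proof. by []. Qed.

(** [expb] is only a crossed homomorphism, but its twist is a sign, which parity ignores; so the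
    sign of [expb] is a character of G_2. *)
Lemma sg_expbM g h : sg (expb (g * h)%g) = sg (expb g) * sg (expb h).
Proof. by rewrite expbM sgD sgM. Qed.

Lemma sg_expaM g h : sg (expa (g * h)%g) = sg (expa g) * sg (expa h).
Proof. by rewrite expaM sgD. Qed.

Definition cv2 (R : nzRingType) (x y : R) : 'cV[R]_2 :=
  \col_i (if i == 0 then x else y).

Lemma cv2_0 (R : nzRingType) (x y : R) : cv2 x y 0 0 = x.
Proof. by rewrite mxE. Qed.

Lemma cv2_1 (R : nzRingType) (x y : R) : cv2 x y 1 0 = y.
Proof. by rewrite mxE. Qed.

Lemma cv2P (R : nzRingType) (u v : 'cV[R]_2) :
  u 0 0 = v 0 0 -> u 1 0 = v 1 0 -> u = v.
Proof.
move=> e0 e1; apply/matrixP=> i j; rewrite [j]ord1.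
case: (unliftP 0 i) => [i' ->|-> //].
by rewrite [i']ord1 (_ : lift 0 0 = 1) //; apply/val_inj.
Qed.

Lemma mulmx_cv2 (R : nzRingType) (M : 'M[R]_2) (v : 'cV[R]_2) i :
  (M *m v) i 0 = M i 0 * v 0 0 + M i 1 * v 1 0.
Proof.
rewrite mxE !big_ord_recl big_ord0 addr0.
by rewrite (_ : lift ord0 ord0 = 1) //; apply/val_inj.
Qed.

Section Action.
Variable k : int.

Definition act (g : G2) : 'M[int]_2 := GL2Z_mx (G2_act k g).

Lemma actM g h : act (g * h)%g = act g *m act h. Proof. exact: G2_actM. Qed.
Lemma act1 : act 1%g = 1%:M. Proof. exact: G2_act1. Qed.

Lemma actKV g v : act g *m (act g^-1%g *m v) = v :> 'cV_2.
Proof. by rewrite mulmxA -actM mulgV act1 mul1mx. Qed.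

Lemma act_a : act G2_a = matA. Proof. by rewrite /act G2_act_a. Qed.
Lemma act_b : act G2_b = matB k. Proof. by rewrite /act G2_act_b. Qed.

Lemma matA0 (v : 'cV_2) : (matA *m v) 0 0 = v 1 0.
Proof. by rewrite mulmx_cv2 !mxE /= mul0r add0r mul1r. Qed.
Lemma matA1 (v : 'cV_2) : (matA *m v) 1 0 = v 0 0.
Proof. by rewrite mulmx_cv2 !mxE /= mul0r addr0 mul1r. Qed.
Lemma matB0 (v : 'cV_2) : (matB k *m v) 0 0 = v 1 0.
Proof. by rewrite mulmx_cv2 !mxE /= mul0r add0r mul1r. Qed.
Lemma matB1 (v : 'cV_2) : (matB k *m v) 1 0 = k * v 1 0 - v 0 0.
Proof. by rewrite mulmx_cv2 !mxE /= mulN1r addrC. Qed.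

Lemma HM (x y : H k) : (x * y)%g = (x.1 + act x.2 *m y.1, (x.2 * y.2)%g) :> H k.
Proof. by []. Qed.

End Action.

(** * The candidate crossed homomorphisms modulo p and the simplicity of their modules *)

Section ModP.
Variables (p : nat) (p_pr : prime p).

Lemma intr_Fp_eq0 (m : int) : (m%:~R == 0 :> 'F_p) = (p%:Z %| m)%Z.
Proof. by rewrite -(dvdz_pcharf (pchar_Fp p_pr)). Qed.

Lemma natr_Fp (u : 'F_p) : (val u)%:Z%:~R = u.
Proof. by rewrite -pmulrn natr_Zp. Qed.

Lemma scale_closed (W : lmodType 'F_p) (S : set W) (c : 'F_p) u :
  S 0 -> (forall u v, S u -> S v -> S (u + v)) -> S u -> S (c *: u).
Proof.
move=> S0 SD Su; rewrite -[c]natr_Zp scaler_nat.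
by elim: (val c) => [|i IH]; rewrite ?mulr0n // mulrS; exact: SD.
Qed.

Lemma Fp_simple (S : set 'F_p) u v :
  S 0 -> (forall u v, S u -> S v -> S (u + v)) -> S u -> u <> 0 -> S v.
Proof.
move=> S0 SD Su /eqP u0; rewrite -[v](divfK u0) -[v / u]natr_Zp mulr_natl.
by elim: (val (v / u)) => [|i IH]; rewrite ?mulr0n // mulrS; exact: SD.
Qed.

End ModP.

Section Characters.
Variables (k : int) (p : nat).

(* For t = -1 (resp. t = 1) the linear form v_0 + t v_1 mod p is an
   eigenvector of the dual action as soon as k = 2 (resp. k = -2) mod p. *)
Definition linform (t : 'F_p) (v : 'cV[int]_2) : 'F_p :=
  (v 0 0)%:~R + t * (v 1 0)%:~R.

Lemma linformD t u v : linform t (u + v) = linform t u + linform t v.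
Proof. by rewrite /linform !mxE; ring. Qed.

Lemma linform0 t : linform t 0 = 0.
Proof. by rewrite /linform !mxE; ring. Qed.

(** With k = -2t the characteristic polynomial of B is (X + t)^2, and the form is multiplied by t
    under A and by -t under B. Compatibility with products reduces the claim to these two
    generators. *)
Lemma linform_act t (chi : G2 -> 'F_p) : t * t = 1 -> k%:~R = - t *+ 2 ->
    chi 1%g = 1 -> (forall g h, chi (g * h)%g = chi g * chi h) ->
    chi G2_a = t -> chi G2_b = - t ->
  forall g v, linform t (act k g *m v) = chi g * linform t v.
Proof.
move=> tt kt chi1 chiM chia chib g.
pose Q := [set g : G2 | forall v, linform t (act k g *m v) = chi g * linform t v].
suff : Q g by []; apply: G2_gen.
- apply: is_subgroupI => [v|x y Qx Qy v|x Qx v].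
  + by rewrite act1 mul1mx chi1 mul1r.
  + by rewrite actM -mulmxA Qx Qy chiM mulrA.
  + by rewrite -[v in RHS](actKV k x) Qx mulrA -chiM mulVg chi1 mul1r.
- move=> v; rewrite act_a /linform matA0 matA1 chia mulrDr mulrA tt.
  by rewrite mul1r addrC.
- move=> v; rewrite act_b /linform matB0 matB1 chib rmorphB rmorphM /= kt.
  have tt' : t ^+ 2 = 1 by rewrite expr2.
  by ring: tt'.
Qed.

End Characters.

Section Cocycles.
Variables (k : int) (p : nat) (p_pr : prime p).
Implicit Types (h : H k) (y x : 'F_p).


Definition modp (v : 'cV[int]_2) : 'cV['F_p]_2 := map_mx intr v.
Definition actp (g : G2) : 'M['F_p]_2 := map_mx intr (act k g).

Lemma modpD u v : modp (u + v) = modp u + modp v.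
Proof. exact: map_mxD. Qed.
Lemma modp_act g v : modp (act k g *m v) = actp g *m modp v.
Proof. exact: map_mxM. Qed.
Lemma actpM (g h : G2) : actp (g * h)%g = actp g *m actp h.
Proof. by rewrite /actp actM map_mxM. Qed.
Lemma actp1 : actp 1%g = 1%:M.
Proof. by rewrite /actp act1 map_mx1. Qed.

(** On G_2 this is the inner crossed homomorphism defined by -y: it vanishes at a and equals 2y at
    b. *)
Definition cocycle_sgn (y : 'F_p) h : 'F_p :=
  linform 1 h.1 + (1 - (sg (expb h.2))%:~R) * y.

(** The values at a and b are x and y. With c = 1 (and k = 2 mod p) the kernel does not contain Z^2;
    with c = 0 and y = 1 it contains Z^2 but not b, and the freedom to rescale delta is spent on
    delta b = 1. One formula serves both because the action is the sign of [expa] each time. *)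
Definition cocycle_line (c y x : 'F_p) h : 'F_p :=
  c * linform (-1) h.1 + (expb h.2)%:~R * y + (parity (expa h.2))%:~R * x.

Definition cocycle_expa h : 'F_p := (expa h.2)%:~R.

Definition cocycle_plane (w : 'cV['F_p]_2) h : 'cV['F_p]_2 :=
  modp h.1 + (actp h.2 *m w - w).

Lemma linform_actN : k%:~R = 2 :> 'F_p -> forall g v,
  linform (-1) (act k g *m v) = (sg (expa g))%:~R * linform (-1) v :> 'F_p.
Proof.
move=> k2; apply: (linform_act (chi := fun g => (sg (expa g))%:~R)).
- by rewrite mulrNN mulr1.
- by rewrite opprK.
- by rewrite expa1 sg0.
- by move=> g h; rewrite sg_expaM rmorphM.
- by rewrite expa_a.
- by rewrite expa_b opprK sg0.
Qed.

Lemma linform_actP : k%:~R = -2 :> 'F_p -> forall g v,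
  linform 1 (act k g *m v) = (sg (expb g))%:~R * linform 1 v :> 'F_p.
Proof.
move=> k2; apply: (linform_act (chi := fun g => (sg (expb g))%:~R)).
- by rewrite mulr1.
- by rewrite k2 mulNrn.
- by rewrite expb1 sg0.
- by move=> g h; rewrite sg_expbM rmorphM.
- by rewrite expb_a sg0.
- by rewrite expb_b.
Qed.

Lemma Fp_neq0 : exists w : 'F_p, w <> 0.
Proof. by exists 1; apply/eqP; exact: oner_neq0. Qed.

Lemma derivation_ker_Fp (delta : H k -> 'F_p) (chi : H k -> 'F_p) (s : 'F_p -> H k) :
    chi 1%g = 1 -> (forall g h, chi (g * h)%g = chi g * chi h) ->
    (forall g h, delta (g * h)%g = delta g + chi g * delta h) ->
    cancel s delta -> (forall w, chi (s w) = 1) ->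
  maximal_subgroups (H k) p (derivation_ker delta).
Proof.
move=> chi1 chiM deltaM sK chis; rewrite -[p in maximal_subgroups _ p](card_Fp p_pr).
have rhoD g u v : chi g * (u + v) = chi g * u + chi g * v by rewrite mulrDr.
have rho1 u : chi 1%g * u = u by rewrite chi1 mul1r.
have rhoM g h u : chi (g * h)%g * u = chi g * (chi h * u) by rewrite chiM mulrA.
split.
  apply: (derivation_ker_maximal rhoD rho1 rhoM deltaM sK) => //.
  - by move=> w u; rewrite chis mul1r.
  - exact: Fp_neq0.
  - by move=> S S0 SD _ [u Su u0] v; exact: (Fp_simple v S0 SD Su u0).
exact: (derivation_ker_index rhoD rho1 rhoM deltaM sK).
Qed.

Lemma cocycle_line_maximal c y x : c = 1 /\ k%:~R = 2 :> 'F_p \/ c = 0 /\ y = 1 ->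
  maximal_subgroups (H k) p (derivation_ker (cocycle_line c y x)).
Proof.
move=> cy.
have line_act g v : c * linform (-1) (act k g *m v) =
    (sg (expa g))%:~R * (c * linform (-1) v).
  case: cy => -[-> ?]; last by rewrite !mul0r mulr0.
  by rewrite !mul1r linform_actN.
(* The section must act trivially: translations are used if delta is onto already on Z^2, powers of
   b otherwise. *)
pose s : 'F_p -> H k := fun w : 'F_p => if c == 1
  then (cv2 (val w)%:Z 0, 1%g) else (0, expgz G2_b (val w)).
apply: (@derivation_ker_Fp _ (fun h => (sg (expa h.2))%:~R) s).
- by rewrite /= expa1 sg0.
- by move=> g h /=; rewrite sg_expaM rmorphM.
- move=> g h; rewrite /cocycle_line /= linformD mulrDr line_act.
  by rewrite expbM expaM parityD !rmorphD !rmorphM /=; ring.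
- move=> w; rewrite /s /cocycle_line; case: cy => -[cE yE].
    rewrite cE eqxx /= expb1 expa1 parity0 /linform cv2_0 cv2_1 natr_Fp.
    by rewrite !mul0r mulr0 mul1r !addr0.
  have -> : (c == 1) = false by rewrite cE eq_sym oner_eq0.
  rewrite cE yE /= expb_expgz expa_expgz expa_b mulr0 parity0.
  by rewrite linform0 natr_Fp !mul0r mulr1 add0r addr0.
- move=> w; rewrite /s; case: ifP => _ /=; first by rewrite expa1 sg0.
  by rewrite expa_expgz expa_b mulr0 sg0.
Qed.

Lemma cocycle_expa_maximal :
  maximal_subgroups (H k) p (derivation_ker cocycle_expa).
Proof.
pose s : 'F_p -> H k := fun w : 'F_p => (0, expgz G2_a (val w)).
apply: (@derivation_ker_Fp _ (fun h => 1) s) => //.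
- by move=> g h; rewrite mulr1.
- by move=> g h; rewrite /cocycle_expa /= expaM rmorphD mul1r.
- by move=> w; rewrite /cocycle_expa /= expa_expgz expa_a mulr1 natr_Fp.
Qed.

Lemma cocycle_sgn_maximal y : k%:~R = -2 :> 'F_p ->
  maximal_subgroups (H k) p (derivation_ker (cocycle_sgn y)).
Proof.
move=> k2; pose s : 'F_p -> H k := fun w : 'F_p => (cv2 (val w)%:Z 0, 1%g).
apply: (@derivation_ker_Fp _ (fun h => (sg (expb h.2))%:~R) s).
- by rewrite /= expb1 sg0.
- by move=> g h /=; rewrite sg_expbM rmorphM.
- move=> g h; rewrite /cocycle_sgn /= linformD linform_actP //.
  by rewrite sg_expbM !rmorphM /=; ring.
- move=> w; rewrite /cocycle_sgn /= expb1 sg0 /linform cv2_0 cv2_1 natr_Fp.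
  by rewrite subrr mul0r mulr0 !addr0.
- by move=> w /=; rewrite expb1 sg0.
Qed.

Definition act_stable (S : set 'cV['F_p]_2) :=
  [/\ S 0, forall u v, S u -> S v -> S (u + v) &
      forall g u, S u -> S (actp g *m u)].

Lemma actp_a0 (u : 'cV_2) : (actp G2_a *m u) 0 0 = u 1 0.
Proof. by rewrite /actp act_a mulmx_cv2 !mxE /= mul0r add0r mul1r. Qed.
Lemma actp_a1 (u : 'cV_2) : (actp G2_a *m u) 1 0 = u 0 0.
Proof. by rewrite /actp act_a mulmx_cv2 !mxE /= mul0r addr0 mul1r. Qed.
Lemma actp_b0 (u : 'cV_2) : (actp G2_b *m u) 0 0 = u 1 0.
Proof. by rewrite /actp act_b mulmx_cv2 !mxE /= mul0r add0r mul1r. Qed.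
Lemma actp_b1 (u : 'cV_2) : (actp G2_b *m u) 1 0 = k%:~R * u 1 0 - u 0 0.
Proof. by rewrite /actp act_b mulmx_cv2 !mxE /= rmorphN mulN1r addrC. Qed.

Section Stable.
Variable S : set 'cV['F_p]_2.
Hypothesis stS : act_stable S.

(** A swaps the two axes, so one nonzero vector on an axis generates the plane. *)
Lemma act_stable_cv2 q v : q != 0 -> S (cv2 0 q) -> S v.
Proof.
have [S0 SD Sact] := stS; move=> q0 Sq.
have Sy z : S (cv2 0 z).
  have -> : cv2 0 z = (z / q) *: cv2 0 q.
    by apply: cv2P; rewrite !mxE /= ?mulr0 // divfK.
  exact: scale_closed.
have -> : v = actp G2_a *m cv2 0 (v 0 0) + cv2 0 (v 1 0).
  by apply: cv2P; rewrite mxE ?actp_a0 ?actp_a1 !mxE /= ?addr0 ?add0r.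
by apply: SD => //; exact: Sact.
Qed.

(* (B - A) u = (0, k u_1 - 2 u_0). *)
Lemma act_stable_diff u v : S u -> k%:~R * u 1 0 != u 0 0 *+ 2 -> S v.
Proof.
have [S0 SD Sact] := stS; move=> Su; rewrite -subr_eq0 => q0.
apply: (act_stable_cv2 _ q0).
have -> : cv2 0 (k%:~R * u 1 0 - u 0 0 *+ 2) =
    actp G2_b *m u + (-1) *: (actp G2_a *m u).
  by apply: cv2P; rewrite [LHS]mxE [RHS]mxE [X in _ = _ + X]mxE
    ?(actp_a0, actp_a1, actp_b0, actp_b1) /=; ring.
by apply: (SD); [exact: Sact|exact: (scale_closed (-1) S0 SD (Sact _ _ Su))].
Qed.

(** [act_stable_diff] is tried on u and on A u. If both fail, then k u_1 = 2 u_0 and k u_0 = 2 u_1,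
    whence (k^2 - 4) u = 0. *)
Lemma act_stable_irr u v : k%:~R ^+ 2 != 4 :> 'F_p -> S u -> u <> 0 -> S v.
Proof.
have [S0 SD Sact] := stS; move=> k4 Su u0.
have [e1|] := eqVneq (k%:~R * u 1 0) (u 0 0 *+ 2); last exact: act_stable_diff.
have Sau : S (actp G2_a *m u) by exact: Sact.
have := @act_stable_diff _ v Sau; rewrite actp_a0 actp_a1.
have [e2 _|] := eqVneq (k%:~R * u 0 0) (u 1 0 *+ 2); last by move=> ne; apply.
have e i : (k%:~R ^+ 2 - 4) * u i 0 = 0.
  have [->|->] : i = 0 \/ i = 1.
    by case: (unliftP 0 i) => [j ->|->]; [right; apply/val_inj; rewrite [j]ord1|left].
  - have -> : (k%:~R ^+ 2 - 4) * u 0 0 =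
      k%:~R * (k%:~R * u 0 0 - u 1 0 *+ 2) + (k%:~R * u 1 0 - u 0 0 *+ 2) *+ 2 by ring.
    by rewrite e1 e2 !subrr; ring.
  - have -> : (k%:~R ^+ 2 - 4) * u 1 0 =
      k%:~R * (k%:~R * u 1 0 - u 0 0 *+ 2) + (k%:~R * u 0 0 - u 1 0 *+ 2) *+ 2 by ring.
    by rewrite e1 e2 !subrr; ring.
case: u0; apply/matrixP=> i j; rewrite [j]ord1 mxE.
by move/eqP: (e i); rewrite mulf_eq0 subr_eq0 (negPf k4) => /eqP.
Qed.

(** For odd p, (B - A) u has second coordinate -2 (u_0 + t u_1), which is nonzero. For p = 2 the
    matrices A and B agree, but then t = 1, and u_0 + u_1 <> 0 leaves only the two unit vectors. *)
Lemma act_stable_line t u v : t * t = 1 -> k%:~R = - t *+ 2 ->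
  S u -> u 0 0 + t * u 1 0 <> 0 -> S v.
Proof.
have [S0 SD Sact] := stS; move=> tt kt Su /eqP ut.
have [two0|two] := eqVneq (2 : 'F_p) 0; last first.
  apply: (@act_stable_diff u) => //; rewrite kt -subr_eq0.
  have -> : - t *+ 2 * u 1 0 - u 0 0 *+ 2 = - (2 * (u 0 0 + t * u 1 0)) by ring.
  by rewrite oppr_eq0 mulf_neq0.
have sq0 (z : 'F_p) : z = 0 \/ z = 1.
  have p2 : p = 2%N.
    apply/eqP; rewrite -dvdn_prime2 //.
    by rewrite (dvdn_pcharf (pchar_Fp p_pr)); apply/eqP.
  rewrite -[z]natr_Zp; have : (nat_of_ord z < 2)%N.
    by apply: leq_trans (ltn_ord z) _; rewrite Fp_cast // p2.
  by case: (nat_of_ord z) => [|[|i]] // _; [left|right].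
have t1 : t = 1.
  by case: (sq0 t) tt => -> //; rewrite mul0r => /esym/eqP; rewrite oner_eq0.
move: ut; rewrite t1 mul1r.
case: (sq0 (u 0 0)) => u0; case: (sq0 (u 1 0)) => u1; rewrite u0 u1 ?addr0 ?eqxx //.
- move=> _; apply: (act_stable_cv2 _ (oner_neq0 _)).
  by rewrite (_ : cv2 0 1 = u) //; apply: cv2P; rewrite !mxE.
- move=> _; apply: (act_stable_cv2 _ (oner_neq0 _)).
  rewrite (_ : cv2 0 1 = actp G2_a *m u); first exact: Sact.
  by apply: cv2P; rewrite ?actp_a0 ?actp_a1 !mxE.
- by rewrite -[1 + 1]/(2 : 'F_p) two0 eqxx.
Qed.

End Stable.

Lemma cocycle_plane_maximal (w : 'cV['F_p]_2) : k%:~R ^+ 2 != 4 :> 'F_p ->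
  maximal_subgroups (H k) (p ^ 2) (derivation_ker (cocycle_plane w)).
Proof.
move=> k4.
have -> : (p ^ 2)%N = #|{: 'cV['F_p]_2}| by rewrite card_mx card_Fp // muln1.
pose rho (h : H k) (u : 'cV['F_p]_2) := actp h.2 *m u.
pose s (u : 'cV['F_p]_2) : H k := (cv2 (val (u 0 0))%:Z (val (u 1 0))%:Z, 1%g).
have rhoD g u v : rho g (u + v) = rho g u + rho g v by exact: mulmxDr.
have rho1 u : rho 1%g u = u by rewrite /rho actp1 mul1mx.
have rhoM g h u : rho (g * h)%g u = rho g (rho h u) by rewrite /rho actpM mulmxA.
have deltaM g h : cocycle_plane w (g * h)%g =
    cocycle_plane w g + rho g (cocycle_plane w h).
  rewrite /cocycle_plane /rho /= modpD modp_act actpM.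
  rewrite !mulmxDr mulmxN !mulmxA -!addrA; congr (_ + _).
  by rewrite [RHS]addrCA [X in _ + (_ + X)]addrA subrKC [RHS]addrC -addrA.
have sK : cancel s (cocycle_plane w).
  move=> u; rewrite /cocycle_plane /= actp1 mul1mx subrr addr0.
  by apply: cv2P; rewrite !mxE /= natr_Fp.
split.
  apply: (derivation_ker_maximal rhoD rho1 rhoM deltaM sK).
  - by move=> ? ?; rewrite /rho /= actp1 mul1mx.
  - by exists (cv2 0 1) => /matrixP/(_ 1 0)/eqP; rewrite !mxE /= oner_eq0.
  - move=> S S0 SD Srho [u Su u0] v; apply: act_stable_irr k4 Su u0.
    by split=> // g z; exact: (Srho (0, g)).
exact: (derivation_ker_index rhoD rho1 rhoM deltaM sK).
Qed.

End Cocycles.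

Lemma is_subgroupXz (G : groupType) (M : set G) x m :
  is_subgroup M -> M x -> M (expgz x m).
Proof.
by move=> sM Mx; case: m => m; [|apply: (is_subgroupV sM)]; exact: is_subgroupX.
Qed.

(** * Classification *)

Section IntSubgroups.
Variable K : set int.
Hypotheses (K0 : K 0) (KD : forall u v, K u -> K v -> K (u + v)).
Hypothesis KN : forall u, K u -> K (- u).

Lemma int_subgroup_mull c m : K c -> K (m * c).
Proof.
move=> Kc; have Kn (n : nat) : K (n%:Z * c).
  elim: n => [|n IH]; first by rewrite mul0r.
  by rewrite -addn1 PoszD mulrDl mul1r; exact: KD.
by case: (intP m) => [|n|n]; [rewrite mul0r|exact: Kn|rewrite mulNr; exact/KN/Kn].
Qed.

Lemma int_subgroup_dvd (p : nat) : prime p -> K p%:Z -> ~ K 1 ->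
  forall v, K v <-> (p%:Z %| v)%Z.
Proof.
move=> p_pr Kp K1 v; split=> [Kv|/dvdzP[q ->]]; last exact: int_subgroup_mull.
apply: contrapT => /negP pv; apply: K1.
have [u [w uw]] := Bezoutz p%:Z v.
have -> : 1 = gcdz p%:Z v.
  apply/esym/eqP; rewrite -[_ == _]/(coprimez _ _).
  by rewrite coprimezE prime_coprime.
by rewrite -uw; apply: KD; exact: int_subgroup_mull.
Qed.

End IntSubgroups.

Section Slices.
Variables (k : int) (M : set (H k)).
Hypothesis sM : is_subgroup M.

Lemma slice_subgroup : is_subgroup [set g : G2 | M (0, g)].
Proof.
apply: is_subgroupI => [|g h /= Mg Mh|g /= Mg]; first exact: (is_subgroup1 sM).
  have : M (((0, g) : H k) * (0, h))%g by exact: (is_subgroupM sM).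
  by rewrite HM /= mulmx0 addr0.
have -> : (0, g^-1%g) = ((0, g) : H k)^-1%g :> H k.
  by apply: (mulIg ((0, g) : H k)); rewrite mulVg HM /= mulmx0 addr0 mulVg.
exact: (is_subgroupV sM).
Qed.

Lemma H_split v g : (v, g) = (((v, 1%g) : H k) * (0, g))%g :> H k.
Proof. by rewrite HM /= mulmx0 addr0 mul1g. Qed.

Lemma H_gen : (forall v, M (v, 1%g)) -> M (0, G2_a) -> M (0, G2_b) ->
  forall h, M h.
Proof.
move=> MN Ma Mb [v g]; rewrite H_split; apply: (is_subgroupM sM) => //.
exact: (G2_gen slice_subgroup Ma Mb).
Qed.

End Slices.

Section Generators.
Variable k : int.

Definition trans (v : 'cV[int]_2) : H k := (v, 1%g).
Definition powb (m : int) : H k := (0, expgz G2_b m).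
Definition powa (m : int) : H k := (0, expgz G2_a m).

Lemma transD u v : trans (u + v) = (trans u * trans v)%g.
Proof. by rewrite HM /= -/(act k 1%g) act1 mul1mx mulg1. Qed.
Lemma powbD u v : powb (u + v) = (powb u * powb v)%g.
Proof. by rewrite HM /= mulmx0 addr0 -expgzD. Qed.
Lemma powaD u v : powa (u + v) = (powa u * powa v)%g.
Proof. by rewrite HM /= mulmx0 addr0 -expgzD. Qed.

Definition act_trans (h : H k) (v : 'cV[int]_2) := act k h.2 *m v.
Definition act_powb (h : H k) (m : int) := sg (expa h.2) * m.
Definition act_powa (h : H k) (m : int) := m.

Lemma trans_comm (g : H k) u v :
  [set 1%g] (trans u * g * trans v * (trans (u + act_trans g v) * g)^-1)%g.
Proof.
suff -> : (trans u * g * trans v = trans (u + act_trans g v) * g)%g by rewrite mulgV.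
rewrite !HM /= !mul1g mulg1 -/(act k 1%g) act1 !mul1mx /act_trans -!addrA.
by rewrite [g.1 + _]addrC.
Qed.

Lemma powb_comm (g : H k) u v :
  [set h : H k | h.2 = 1%g] (powb u * g * powb v * (powb (u + act_powb g v) * g)^-1)%g.
Proof.
rewrite /=; apply: (mulIg (expgz G2_b (u + act_powb g v) * g.2)%g).
by rewrite mulgVK mul1g expgzD -!mulgA G2_expgz_comm.
Qed.

Lemma powa_comm (g : H k) u v :
  [set h : H k | expa h.2 = 0] (powa u * g * powa v * (powa (u + act_powa g v) * g)^-1)%g.
Proof.
by rewrite /= !(expaM, expaV, expa_expgz) expa_a; rewrite /act_powa; ring.
Qed.

End Generators.

Lemma trans0 k : trans k 0 = 1%g. Proof. by []. Qed.
Lemma powb0 k : powb k 0 = 1%g. Proof. by []. Qed.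
Lemma powa0 k : powa k 0 = 1%g. Proof. by []. Qed.
Lemma powa1 k : powa k 1 = (0, G2_a). Proof. by []. Qed.
Lemma powb1 k : powb k 1 = (0, G2_b). Proof. by []. Qed.

Lemma act_transD k (g : H k) u v :
  act_trans g (u + v) = act_trans g u + act_trans g v.
Proof. exact: mulmxDr. Qed.
Lemma act_powbD k (g : H k) u v : act_powb g (u + v) = act_powb g u + act_powb g v.
Proof. exact: mulrDr. Qed.
Lemma act_powaD k (g : H k) u v : act_powa g (u + v) = act_powa g u + act_powa g v.
Proof. by []. Qed.

(** The product set is a subgroup, so it is everything once it contains the translations, a and
    b. *)
Lemma supplement_eq_gen k (V : zmodType) (iota : V -> H k) rho P (M1 M2 : set (H k)) :
    iota 0 = 1%g ->
    (forall g u v, P (iota u * g * iota v * (iota (u + rho g v) * g)^-1)%g) ->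
    is_subgroup M1 -> is_subgroup M2 -> P `<=` M1 -> P `<=` M2 ->
    (forall v, M1 (iota v) <-> M2 (iota v)) ->
    (forall v, prodV iota setT (M1 `&` M2) (v, 1%g)) ->
    prodV iota setT (M1 `&` M2) (0, G2_a) ->
    prodV iota setT (M1 `&` M2) (0, G2_b) ->
  M1 = M2.
Proof.
move=> iota0 comm sM1 sM2 PM1 PM2 eqM Nprod aprod bprod.
apply: (supplement_eq sM1 sM2 eqM); apply/seteqP; split=> // h _.
apply: H_gen => //.
apply: (prodV_subgroup iota0 comm (is_subgroupI2 sM1 sM2)) => //.
by move=> x Px; split; [exact: PM1|exact: PM2].
Qed.

Section Classification.
Variables (k : int) (M : set (H k)) (n : nat).
Hypothesis maxM : maximal_subgroups (H k) n M.

Let mxM : is_maximal_subgroup M. Proof. by case: maxM. Qed.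
Let sM : is_subgroup M. Proof. by case: mxM. Qed.
Let idxM : has_index M n. Proof. by case: maxM. Qed.

Lemma maximal_proper :
  (forall h, M h) -> False.
Proof.
move=> MT; have [_ + _] := mxM; apply.
by apply/seteqP; split.
Qed.

Lemma has_index_pos (iota : int -> H k) :
    iota 0 = 1%g -> (forall u v, iota (u + v) = (iota u * iota v)%g) ->
  exists2 m : nat, (0 < m)%N & M (iota m).
Proof.
move=> iota0 iotaD; have [j j0 Mj] := has_index_expg (iota 1) sM idxM.
by exists j; rewrite // -[j : int]natz (iotaMn iota0 iotaD).
Qed.

(** Finite index puts a positive integer in the trace, simplicity of the quotient makes it a prime,
    and a proper subgroup of Z containing a prime p is pZ. *)
Lemma classify_int (iota : int -> H k) (rho : H k -> int -> int) P :
    iota 0 = 1%g -> (forall u v, iota (u + v) = (iota u * iota v)%g) ->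
    (forall g u v, rho g (u + v) = rho g u + rho g v) ->
    (forall g u v, P (iota u * g * iota v * (iota (u + rho g v) * g)^-1)%g) ->
    P `<=` M -> ~ M (iota 1) ->
  exists2 p : nat, prime p & forall v, M (iota v) <-> (p%:Z %| v)%Z.
Proof.
move=> iota0 iotaD rhoD comm PM M1.
have LT : exists v, ~ [set v | M (iota v)] v by exists 1.
have [L0 LD LN _] := trace_stable iota0 iotaD comm mxM PM LT.
have [m m0 Lm] := @has_index_pos iota iota0 iotaD.
have LmV v : [set v | M (iota v)] (v *+ m).
  by rewrite -mulr_natr natz; exact: int_subgroup_mull.
have [p p_pr Lp] := trace_prime iota0 iotaD rhoD comm mxM PM LT m0 LmV.
exists p => //; apply: (int_subgroup_dvd L0 LD LN p_pr) => //.
by have := Lp 1; rewrite -[1 *+ p]/(p%:R) natz.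
Qed.

Lemma classify_expa : (forall v, M (v, 1%g)) -> M (0, G2_b) ->
  exists2 p, prime p & M = derivation_ker (@cocycle_expa k p).
Proof.
move=> MN Mb.
have PM : [set h : H k | expa h.2 = 0] `<=` M.
  move=> [v g] /= g0; have [m ->] := G2_normal_form g; rewrite g0 expgz0 mulg1.
  rewrite H_split; apply: (is_subgroupM sM) => //.
  exact: (is_subgroupXz m (slice_subgroup sM)).
have Ma : ~ M (0, G2_a).
  by move=> Ma; apply: maximal_proper => //; exact: H_gen.
have [p p_pr Lp] := classify_int (powa0 k) (@powaD k) (@act_powaD k) (@powa_comm k) PM Ma.
exists p => //; have [[sK _ _] _] := cocycle_expa_maximal k p_pr.
apply: (supplement_eq_gen (powa0 k) (@powa_comm k) sM sK PM).
- by move=> h /= h0; rewrite /derivation_ker /= /cocycle_expa h0.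
- move=> v; rewrite Lp -intr_Fp_eq0 // /derivation_ker /= /cocycle_expa /=.
  by rewrite expa_expgz expa_a mulr1; split=> [/eqP|->].
- move=> v; exists 0 => //; rewrite powa0 mul1g; split=> //.
  by rewrite /derivation_ker /= /cocycle_expa /= expa1.
- by rewrite -powa1; apply: (prodV_iota (powa0 k) (@powaD k) (is_subgroupI2 sM sK));
    first exact: (rho_stableT (@act_powa k)).
- exists 0 => //; rewrite powa0 mul1g; split=> //.
  by rewrite /derivation_ker /= /cocycle_expa /= expa_b.
Qed.

Lemma classify_expb : (forall v, M (v, 1%g)) -> ~ M (0, G2_b) ->
  exists2 p, prime p & exists x, M = derivation_ker (@cocycle_line k p 0 1 x).
Proof.
move=> MN Mb.
have PM : [set h : H k | h.2 = 1%g] `<=` M by move=> [v g] /= ->.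
have LT : exists v, ~ [set v | M (powb k v)] v by exists 1.
have [p p_pr Lp] := classify_int (powb0 k) (@powbD k) (@act_powbD k) (@powb_comm k) PM Mb.
have [i Mi] := iota_supplement (powb0 k) (@powbD k) (@powb_comm k) mxM PM LT (0, G2_a).
(* As b^i a lies in [M], the value i + x of the candidate there has to vanish. *)
exists p => //; exists (- i%:~R).
have cy : 0 = 1 :> 'F_p /\ k%:~R = 2 :> 'F_p \/ 0 = 0 :> 'F_p /\ 1 = 1 :> 'F_p.
  by right.
have [[sK _ _] _] := cocycle_line_maximal p_pr (- i%:~R) cy.
apply: (supplement_eq_gen (powb0 k) (@powb_comm k) sM sK PM).
- move=> h /= h0; rewrite /derivation_ker /= /cocycle_line h0 expb1 expa1 parity0.
  by rewrite !mul0r !addr0.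
- move=> v; rewrite Lp -intr_Fp_eq0 // /derivation_ker /= /cocycle_line /=.
  rewrite expb_expgz expa_expgz expa_b mulr0 parity0 !mul0r add0r addr0 mulr1.
  by split=> [/eqP|->].
- move=> v; exists 0 => //; rewrite powb0 mul1g; split=> //.
  rewrite /derivation_ker /= /cocycle_line /= expb1 expa1 parity0.
  by rewrite !mul0r !addr0.
- exists i => //; split=> //; rewrite /derivation_ker /= /cocycle_line /=.
  rewrite expbM expaM expb_expgz expa_expgz expb_a expa_a expa_b mulr0 add0r.
  by rewrite mulr0 addr0 parity1 mul0r add0r mulr1 mul1r subrr.
- by rewrite -powb1; apply: (prodV_iota (powb0 k) (@powbD k) (is_subgroupI2 sM sK));
    first exact: (rho_stableT (@act_powb k)).
Qed.

End Classification.

Lemma int_mulrn (z : int) (n : nat) : z *+ n = z * n%:Z.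
Proof. by rewrite -mulr_natr natz. Qed.

Lemma cv2D (R : nzRingType) (u v : 'cV[R]_2) i : (u + v) i 0 = u i 0 + v i 0.
Proof. by rewrite mxE. Qed.

Lemma cv2N (R : nzRingType) (u : 'cV[R]_2) i : (- u) i 0 = - u i 0.
Proof. by rewrite mxE. Qed.

Section Lift.
Variables (p : nat) (p_pr : prime p).

Definition lift_Fp (u : 'cV['F_p]_2) : 'cV[int]_2 :=
  cv2 (val (u 0 0))%:Z (val (u 1 0))%:Z.

Lemma lift_FpK u : modp p (lift_Fp u) = u.
Proof. by apply: cv2P; rewrite !mxE /= natr_Fp. Qed.

Lemma modp_eq0 v : modp p v = 0 -> exists w, v = w *+ p.
Proof.
move=> v0; have dv i : (p%:Z %| v i ord0)%Z.
  by rewrite -intr_Fp_eq0 //; have /matrixP/(_ i 0) := v0; rewrite !mxE => ->.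
exists (cv2 (divz (v 0 0) p) (divz (v 1 0) p)).
by apply: cv2P; rewrite mulmxnE !mxE /= int_mulrn divzK.
Qed.

Lemma modpN v : modp p (- v) = - modp p v. Proof. exact: map_mxN. Qed.
End Lift.

(** * Maximal subgroups that do not contain Z^2 *)

Section TypeI.
Variables (k : int) (M : set (H k)) (n : nat).
Hypothesis maxM : maximal_subgroups (H k) n M.
Hypothesis MN : exists v, ~ M (v, 1%g).

Let mxM : is_maximal_subgroup M. Proof. by case: maxM. Qed.
Let sM : is_subgroup M. Proof. by case: mxM. Qed.
Let idxM : has_index M n. Proof. by case: maxM. Qed.
Let PM : [set 1%g] `<=` M. Proof. by move=> _ ->; exact: is_subgroup1. Qed.

Let stL := trace_stable (trans0 k) (@transD k) (@trans_comm k) mxM PM MN.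

Lemma trans_prime : exists2 p, prime p & forall v, M (v *+ p, 1%g).
Proof.
have [m1 m1_gt0 Mm1] := has_index_expg (trans k (cv2 1 0)) sM idxM.
have [m2 m2_gt0 Mm2] := has_index_expg (trans k (cv2 0 1)) sM idxM.
rewrite -(iotaMn (trans0 k) (@transD k)) in Mm1.
rewrite -(iotaMn (trans0 k) (@transD k)) in Mm2.
have [L0 LD LN _] := stL.
have Lz v (m : int) : M (trans k v) -> M (trans k (m *: v)).
  move=> Lv; have Ln (j : nat) : M (trans k (j%:Z *: v)).
    elim: j => [|j IH]; first by rewrite scale0r.
    by rewrite intS scalerDl scale1r; exact: LD.
  by case: (intP m) => [|j|j]; [rewrite scale0r|exact: Ln|rewrite scaleNr; exact/LN/Ln].
apply: (trace_prime (trans0 k) (@transD k) (@act_transD k) (@trans_comm k) mxM PM MN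
  (m := (m1 * m2)%N)) => [|v]; first by rewrite muln_gt0 m1_gt0.
(* [m1] and [m2] bring the two basis vectors into [M], so their product brings in every
   translation. *)
have -> : v *+ (m1 * m2) =
    (v 0 0 * m2%:Z) *: (cv2 1 0 *+ m1) + (v 1 0 * m1%:Z) *: (cv2 0 1 *+ m2).
  by apply: cv2P; rewrite mulmxnE !mxE !mulmxnE !mxE /=;
    rewrite !int_mulrn PoszM; ring.
by apply: LD; exact: Lz.
Qed.

Variables (p : nat) (p_pr : prime p).
Hypothesis Mp : forall v, M (v *+ p, 1%g).

Let S : set 'cV['F_p]_2 := [set u | M (lift_Fp u, 1%g)].

(** [M] contains p Z^2, so membership of a translation depends on its residue only, and the lift
    chosen in [S] is immaterial. *)
Lemma trace_modpP v : M (v, 1%g) <-> S (modp p v).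
Proof.
have [L0 LD LN _] := stL.
have Leq u w : modp p u = modp p w -> M (trans k u) -> M (trans k w).
  move=> uw Lu; have [z zE] : exists z, w - u = z *+ p.
    by apply: modp_eq0 => //; rewrite modpD modpN uw subrr.
  by rewrite -(subrK u w) zE addrC; apply: LD => //; exact: Mp.
by rewrite /S /=; split; apply: Leq; rewrite lift_FpK.
Qed.

Lemma trace_modp_stable : act_stable k S.
Proof.
have [L0 LD LN Lact] := stL; split=> [|u v Su Sv|g u Su].
- by have := (trace_modpP 0).1 (is_subgroup1 sM); rewrite /modp map_mx0.
- have := (trace_modpP _).1 (LD _ _ Su Sv).
  by rewrite modpD !lift_FpK.
- have := (trace_modpP _).1 (Lact (0, g) _ Su).
  by rewrite modp_act lift_FpK.
Qed.

Lemma trace_modp_proper : ~ (forall u, S u).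
Proof. by move=> ST; have [v Mv] := MN; apply/Mv/trace_modpP/ST. Qed.

(* From b a b = a in G_2. *)
Lemma generators_relation : exists x y : 'cV[int]_2,
  [/\ M (x, G2_a), M (y, G2_b) &
      M (y + act k G2_b *m x + act k (G2_b * G2_a)%g *m y - x, 1%g)].
Proof.
have [x Mx] := iota_supplement (trans0 k) (@transD k) (@trans_comm k) mxM PM MN (0, G2_a).
have [y My] := iota_supplement (trans0 k) (@transD k) (@trans_comm k) mxM PM MN (0, G2_b).
have bab : (G2_b * G2_a * G2_b = G2_a)%g by rewrite -mulgA G2_ab mulVKg.
have {}Mx : M (x, G2_a) by rewrite H_split.
have {}My : M (y, G2_b) by rewrite H_split.
exists x, y; split=> //.
apply/(is_subgroup_mull _ sM Mx).
have -> : (((y + act k G2_b *m x + act k (G2_b * G2_a)%g *m y - x, 1%g) : H k) *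
    (x, G2_a) = ((y, G2_b) : H k) * (x, G2_a) * (y, G2_b))%g.
  by rewrite !HM /= -/(act k 1%g) act1 mul1mx mul1g subrK bab.
by apply: is_subgroupM => //; exact: is_subgroupM.
Qed.

Lemma supplement_eq_trans (M2 : set (H k)) x y :
    is_subgroup M2 -> (forall v, M (v, 1%g) <-> M2 (v, 1%g)) ->
    M (x, G2_a) -> M (y, G2_b) -> M2 (x, G2_a) -> M2 (y, G2_b) ->
  M = M2.
Proof.
move=> sM2 eqM Mx My M2x M2y.
apply: (supplement_eq_gen (trans0 k) (@trans_comm k) sM sM2 PM) => //.
- by move=> _ ->; exact: is_subgroup1.
- move=> v; apply: (prodV_iota (trans0 k) (@transD k) (is_subgroupI2 sM sM2)).
    exact: (rho_stableT (@act_trans k)).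
  by [].
- by exists x => //; rewrite -H_split.
- by exists y => //; rewrite -H_split.
Qed.

Lemma classify_plane : k%:~R ^+ 2 != 4 :> 'F_p ->
  exists w, M = derivation_ker (@cocycle_plane k p w).
Proof.
move=> k4; have [x [y [Mx My]]] := generators_relation.
have S0 u : S u -> u = 0.
  move=> Su; apply: contrapT => u0; apply: trace_modp_proper => v.
  exact: (act_stable_irr trace_modp_stable v k4 Su u0).
move=> /trace_modpP/S0 rel.
have {}rel i : ((y + act k G2_b *m x + act k (G2_b * G2_a)%g *m y - x) i 0)%:~R =
    0 :> 'F_p.
  by move/matrixP/(_ i 0): rel; rewrite [LHS]mxE [RHS]mxE.
have k2 : 2 - k%:~R != 0 :> 'F_p.
  by apply: contra k4; rewrite subr_eq0 => /eqP <-; apply/eqP; ring.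
pose y0 : 'F_p := (y 0 0)%:~R; pose y1 : 'F_p := (y 1 0)%:~R.
(* w is the solution of y + B w - w = 0, the vanishing at (y, b): the first row gives w_0 = w_1 +
   y_0, and the second then gives w_1. The denominator is det (B - 1). *)
pose w1 : 'F_p := (y1 - y0) / (2 - k%:~R).
exists (cv2 (w1 + y0) w1).
have [[sK _ _] _] := cocycle_plane_maximal p_pr (cv2 (w1 + y0) w1) k4.
have w1E : w1 * (2 - k%:~R) = y1 - y0 by rewrite divfK.
(* The two coordinates of the relation force x = (y_0, -y_0) mod p, which is exactly x = w - A w,
   the vanishing at (x, a). *)
have r0 : (x 1 0)%:~R - (x 0 0)%:~R + 2 * y0 = 0 :> 'F_p.
  have := rel 0; rewrite actM act_a act_b -mulmxA !cv2D cv2N !matB0 matA1.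
  by move=> e; rewrite -[RHS]e /y0; ring.
have r1 : (k%:~R - 1) * (x 1 0)%:~R - (x 0 0)%:~R + k%:~R * y0 = 0 :> 'F_p.
  have := rel 1; rewrite actM act_a act_b -mulmxA !cv2D cv2N !matB1 matA0 matA1.
  by move=> e; rewrite -[RHS]e /y0; ring.
have x1E : (x 1 0)%:~R = - y0 :> 'F_p.
  apply: (mulfI k2); apply/eqP; rewrite -subr_eq0 -oppr_eq0; apply/eqP.
  by rewrite -[RHS](subrr 0) -{1}r1 -r0; ring.
have x0E : (x 0 0)%:~R = y0 :> 'F_p.
  by apply/eqP; rewrite -subr_eq0 -oppr_eq0 -r0 x1E; apply/eqP; ring.
apply: (supplement_eq_trans sK _ Mx My).
- move=> v; rewrite trace_modpP /derivation_ker /= /cocycle_plane /= actp1 mul1mx.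
  rewrite subrr addr0; split=> [/S0 //|->].
  by have [] := trace_modp_stable.
- apply: cv2P; rewrite /cocycle_plane /= !cv2D cv2N ?actp_a0 ?actp_a1 !mxE /=.
    by rewrite x0E; ring.
  by rewrite x1E; ring.
- apply: cv2P; rewrite /cocycle_plane /= !cv2D cv2N ?actp_b0 ?actp_b1 !mxE /=.
    by rewrite -/y0; ring.
  by rewrite -/y1 -[y1](subrK y0) -w1E; ring.
Qed.

(** A translation in [M] outside the kernel of the form would generate the whole plane mod p.
    Conversely, if that kernel were not inside the trace, the two together would span Z^2, although
    both lie in the kernel. *)
Lemma trace_linform t (chi : G2 -> 'F_p) : t * t = 1 -> k%:~R = - t *+ 2 ->
    (forall g v, linform t (act k g *m v) = chi g * linform t v) ->
  forall v, M (v, 1%g) <-> linform t v = 0.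
Proof.
move=> tt kt tact v.
have LK u : M (u, 1%g) -> linform t u = 0.
  move=> /trace_modpP Su; apply: contrapT => tu; apply: trace_modp_proper => w.
  by apply: (act_stable_line p_pr trace_modp_stable w tt kt Su); rewrite !mxE.
split=> [|tv]; first exact: LK.
have stK : rho_stable (@act_trans k) [set v | linform t v = 0].
  split=> [|u w /= tu tw|u /= tu|g u /= tu].
  - by rewrite /= linform0.
  - by rewrite linformD tu tw addr0.
  - by apply/eqP; rewrite -oppr_eq0 -sub0r -{1}(linform0 t) -(subrr u) linformD addrK tu.
  - by rewrite tact tu mulr0.
have [KL|LT] := trace_maximal (trans0 k) (@transD k) (@trans_comm k) mxM PM stK.
  exact: KL.
have [u /= tu Lu] := LT (cv2 1 0); have := LK _ Lu; rewrite linformD tu add0r.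
rewrite /linform cv2_0 cv2_1 rmorph0 rmorph1 mulr0 addr0 => /eqP.
by rewrite oner_eq0.
Qed.

Lemma classify_line : k%:~R = 2 :> 'F_p ->
  exists y x, M = derivation_ker (@cocycle_line k p 1 y x).
Proof.
move=> k2; have [x [y [Mx My _]]] := generators_relation.
have ML v : M (v, 1%g) <-> linform (-1 : 'F_p) v = 0.
  apply: trace_linform (linform_actN k2) v; first by rewrite mulrNN mulr1.
  by rewrite k2 opprK.
exists (- linform (-1) y), (- linform (-1) x).
have cy : 1 = 1 :> 'F_p /\ k%:~R = 2 :> 'F_p \/
    1 = 0 :> 'F_p /\ - linform (-1) y = 1 :> 'F_p by left.
have [[sK _ _] _] := cocycle_line_maximal p_pr (- linform (-1) x) cy.
apply: (supplement_eq_trans sK _ Mx My); rewrite /derivation_ker /= /cocycle_line /=.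
- move=> v; rewrite ML expb1 expa1 parity0 !mul0r !addr0 mul1r; exact: iff_refl.
- by rewrite expb_a expa_a parity1 mul0r addr0 !mul1r subrr.
- by rewrite expb_b expa_b parity0 mul0r addr0 !mul1r subrr.
Qed.

Lemma classify_sgn : k%:~R = -2 :> 'F_p -> 2 != 0 :> 'F_p ->
  exists y, M = derivation_ker (@cocycle_sgn k p y).
Proof.
move=> k2 two; have [x [y [Mx My rel]]] := generators_relation.
have ML v : M (v, 1%g) <-> linform (1 : 'F_p) v = 0.
  apply: trace_linform (linform_actP k2) v; first by rewrite mulr1.
  by rewrite k2 mulNrn.
(* Here b and b a both act by -1, so the form takes the value y - x - y - x = -2x on the
   relation. *)
have x0 : linform (1 : 'F_p) x = 0.
  move/ML: rel; rewrite -[x in - x]scale1r -scaleNr.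
  rewrite !linformD !linform_actP // sg_expbM expb_a expb_b sg0 sg1.
  have -> : linform (1 : 'F_p) (-1 *: x) = - linform 1 x.
    by rewrite /linform !mxE !rmorphM /=; ring.
  move=> e; apply: (mulfI two); rewrite mulr0 -[RHS]oppr0 -[in RHS]e.
  by rewrite !rmorphM /=; ring.
(* Halved because [cocycle_sgn] takes twice its parameter as value at b. *)
exists (- linform 1 y / 2).
have [[sK _ _] _] := cocycle_sgn_maximal p_pr (- linform 1 y / 2) k2.
apply: (supplement_eq_trans sK _ Mx My); rewrite /derivation_ker /= /cocycle_sgn /=.
- move=> v; rewrite ML expb1 sg0 subrr mul0r addr0; exact: iff_refl.
- by rewrite expb_a sg0 subrr mul0r addr0.
- have -> : 1 - (sg (expb G2_b))%:~R = 2 :> 'F_p by rewrite expb_b sg1; ring.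
  by rewrite mulrC divfK // subrr.
Qed.

End TypeI.

(** * Arithmetic separating the cases *)

Lemma prime_expn2 (p q : nat) : prime p -> p <> (q ^ 2)%N.
Proof.
move=> p_pr pq; have : (q ^ 2 \in [pred m | prime m])%N by rewrite inE -pq.
rewrite inE; apply/negP/primePn; right.
have q1 : (1 < q)%N.
  by move: (prime_gt1 p_pr); rewrite pq; case: q {pq} => [|[|]].
exists q; last by rewrite expnS dvdn_mulr.
by rewrite q1 expnS expn1 ltn_Pmull // ltnW.
Qed.

Lemma expn2_inj (p q : nat) : (p ^ 2 = q ^ 2)%N -> p = q.
Proof. by move=> /eqP; rewrite eqn_exp2r // => /eqP. Qed.

Section Divisibility.
Variables (k : int) (p : nat) (p_pr : prime p).

Lemma dvdz_sub2 : (p%:Z %| k - 2)%Z <-> k%:~R = 2 :> 'F_p.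
Proof. by rewrite -intr_Fp_eq0 // rmorphB subr_eq0; split=> /eqP. Qed.

Lemma dvdz_add2 : (p%:Z %| k + 2)%Z <-> k%:~R = -2 :> 'F_p.
Proof. by rewrite -intr_Fp_eq0 // rmorphD addr_eq0; split=> /eqP. Qed.

Lemma dvdz_mul22 : (p%:Z %| (k - 2) * (k + 2))%Z = (k%:~R ^+ 2 == 4 :> 'F_p).
Proof.
rewrite -intr_Fp_eq0 // -[RHS]subr_eq0; congr (_ == _).
by rewrite rmorphM rmorphB rmorphD /=; ring.
Qed.

Lemma Fp_2_neq0 : (2 != 0 :> 'F_p) = (2 < p)%N.
Proof.
rewrite -(dvdn_pcharf (pchar_Fp p_pr)) dvdn_prime2 //.
by rewrite ltn_neqAle eq_sym prime_gt1 // andbT eq_sym.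
Qed.

(** For p = 2 the roots 2 and -2 coincide; they are filed under the first alternative, so the second
    can assert that p is odd. *)
Lemma Fp_sqr_eq4 (c : 'F_p) : c ^+ 2 = 4 -> c = 2 \/ c = -2 /\ 2 != 0 :> 'F_p.
Proof.
move=> c4; have [c2|c2] := eqVneq c 2; [by left|right].
have : (c - 2) * (c + 2) == 0.
  have -> : (c - 2) * (c + 2) = c ^+ 2 - 4 by ring.
  by rewrite c4 subrr.
rewrite mulf_eq0 subr_eq0 (negPf c2) addr_eq0 => /eqP cN2; split=> //.
by apply: contra c2 => /eqP two; rewrite cN2 two oppr0.
Qed.

Lemma Fp_2_neqN2 : 2 != 0 :> 'F_p -> 2 <> -2 :> 'F_p.
Proof.
move=> two /eqP; rewrite -subr_eq0 opprK (_ : 2 + 2 = 2 * 2 :> 'F_p); last by ring.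
by rewrite mulf_eq0 (negPf two).
Qed.

End Divisibility.

Section TypeIClassification.
Variables (k : int) (M : set (H k)) (n : nat).
Hypothesis maxM : maximal_subgroups (H k) n M.

Lemma classify_typeI : (exists v, ~ M (v, 1%g)) -> exists2 p, prime p &
  [\/ [/\ n = p, k%:~R = 2 :> 'F_p &
          exists t, M = derivation_ker (@cocycle_line k p 1 t.1 t.2)],
      [/\ n = p, k%:~R = -2 :> 'F_p, 2 != 0 :> 'F_p &
          exists y, M = derivation_ker (@cocycle_sgn k p y)] |
      [/\ n = (p ^ 2)%N, k%:~R ^+ 2 != 4 :> 'F_p &
          exists w, M = derivation_ker (@cocycle_plane k p w)]].
Proof.
move=> MN; have [p p_pr Mp] := trans_prime maxM MN; exists p => //.
have idxM := maxM.2.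
have [k4|k4] := eqVneq (k%:~R ^+ 2 : 'F_p) 4; last first.
  have [w wE] := classify_plane maxM MN p_pr Mp k4.
  constructor 3; split=> //; last by exists w.
  apply: (has_index_inj idxM); rewrite wE.
  exact: (cocycle_plane_maximal p_pr w k4).2.
have [k2|[kN2 two]] := Fp_sqr_eq4 k4.
  have [y [x yxE]] := classify_line maxM MN p_pr Mp k2.
  constructor 1; split=> //; last by exists (y, x).
  apply: (has_index_inj idxM); rewrite yxE.
  by apply: (cocycle_line_maximal p_pr _ _).2; left.
have [y yE] := classify_sgn maxM MN p_pr Mp kN2 two.
constructor 2; split=> //; last by exists y.
apply: (has_index_inj idxM); rewrite yE.
exact: (cocycle_sgn_maximal p_pr y kN2).2.
Qed.

Lemma classify_not_typeI : ~ (exists v, ~ M (v, 1%g)) -> prime n /\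
  (M = derivation_ker (@cocycle_expa k n) \/
   exists x, M = derivation_ker (@cocycle_line k n 0 1 x)).
Proof.
move=> MN'; have {MN'}MN v : M (v, 1%g).
  by apply: contrapT => Mv; apply: MN'; exists v.
have idxM := maxM.2.
have [Mb|Mb] := pselect (M (0, G2_b)).
  have [p p_pr ME] := classify_expa maxM MN Mb.
  have -> : n = p.
    by apply: (has_index_inj idxM); rewrite ME; exact: (cocycle_expa_maximal k p_pr).2.
  by split=> //; left.
have [p p_pr [x ME]] := classify_expb maxM MN Mb.
have -> : n = p.
  apply: (has_index_inj idxM); rewrite ME.
  by apply: (cocycle_line_maximal p_pr _ _).2; right.
by split=> //; right; exists x.
Qed.

End TypeIClassification.

Section Injectivity.
Variables (k : int) (p : nat) (p_pr : prime p).

Lemma linform_lift (t : 'F_p) u : linform t (lift_Fp u) = u 0 0 + t * u 1 0.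
Proof. by rewrite /linform cv2_0 cv2_1 !natr_Fp. Qed.

(** One explicit element of the kernel reveals the parameter: b^(-x) a is in the kernel for x, and
    the candidate for x' takes the value x' - x on it. The lemmas below use the same device. *)
Lemma cocycle_line0_inj : injective (fun x => derivation_ker (@cocycle_line k p 0 1 x)).
Proof.
move=> x x' /seteqP[+ _] => /(_ (0, (expgz G2_b (- (val x)%:Z)%R * G2_a)%g)).
rewrite /derivation_ker /= /cocycle_line /= expbM expaM expb_expgz expa_expgz.
rewrite expb_a expa_a expa_b !mulr0 addr0 add0r parity1 mul0r add0r mulr1.
rewrite !mul1r rmorphN /= natr_Fp addNr => /(_ erefl)/eqP.
by rewrite addrC subr_eq0 => /eqP.
Qed.

Lemma cocycle_line1_inj :
  injective (fun t => derivation_ker (@cocycle_line k p 1 t.1 t.2)).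
Proof.
move=> [y x] [y' x'] /seteqP[+ _] => sub.
have := sub (lift_Fp (cv2 (- y) 0), G2_b); have := sub (lift_Fp (cv2 (- x) 0), G2_a).
rewrite /derivation_ker /= /cocycle_line /= !linform_lift cv2_0 cv2_1.
rewrite expb_b expb_a expa_a expa_b parity0 parity1 cv2_0 cv2_1.
rewrite !mul0r !mulr0 !addr0 !mul1r.
rewrite !addNr => /(_ erefl)/eqP; rewrite addrC subr_eq0 => /eqP ->.
by move=> /(_ erefl)/eqP; rewrite addrC subr_eq0 => /eqP ->.
Qed.

Lemma cocycle_sgn_inj : 2 != 0 :> 'F_p ->
  injective (fun y => derivation_ker (@cocycle_sgn k p y)).
Proof.
move=> two y y' /seteqP[+ _] => /(_ (lift_Fp (cv2 (- (2 * y)) 0), G2_b)).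
rewrite /derivation_ker /= /cocycle_sgn /= !linform_lift cv2_0 cv2_1 mulr0 addr0.
have -> : 1 - (sg (expb G2_b))%:~R = 2 :> 'F_p by rewrite expb_b sg1; ring.
rewrite addNr => /(_ erefl)/eqP; rewrite addrC subr_eq0 => /eqP.
by move=> /(mulfI two).
Qed.

(** Equal kernels give (B - 1) w = (B - 1) w', and B - 1 has determinant 2 - k, nonzero mod p. *)
Lemma cocycle_plane_inj : k%:~R ^+ 2 != 4 :> 'F_p ->
  injective (fun w => derivation_ker (@cocycle_plane k p w)).
Proof.
move=> k4 w w' /seteqP[+ _] => /(_ (lift_Fp (w - actp k p G2_b *m w), G2_b)).
rewrite /derivation_ker /= /cocycle_plane /= lift_FpK addrA subrK subrr.
move=> /(_ erefl) /matrixP e.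
have k2 : 2 - k%:~R != 0 :> 'F_p.
  by apply: contra k4; rewrite subr_eq0 => /eqP <-; apply/eqP; ring.
have := e 0 0; rewrite !cv2D !cv2N !actp_b0 [RHS]mxE => e0.
have := e 1 0; rewrite !cv2D !cv2N !actp_b1 [RHS]mxE => e1.
have w1 : w 1 0 = w' 1 0.
  apply: (mulfI k2); apply/eqP; rewrite -subr_eq0; apply/eqP.
  by rewrite -[RHS](subrr 0) -[in X in _ = X - _]e1 -[in X in _ = _ - X]e0; ring.
apply: cv2P => //.
by apply/eqP; rewrite -subr_eq0; apply/eqP; rewrite -[RHS]e0 w1; ring.
Qed.

End Injectivity.

(** * Counting *)

Section Counts.
Variables (k : int) (p : nat) (p_pr : prime p).

Lemma trans_cocycle_line0 x v :
  derivation_ker (@cocycle_line k p 0 1 x) (v, 1%g).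
Proof.
by rewrite /derivation_ker /= /cocycle_line /= expb1 expa1 parity0 !mul0r !addr0.
Qed.

Lemma trans_cocycle_expa v : derivation_ker (@cocycle_expa k p) (v, 1%g).
Proof. by rewrite /derivation_ker /= /cocycle_expa /= expa1. Qed.

Lemma trans_cocycle_line1 y x :
  ~ derivation_ker (@cocycle_line k p 1 y x) (cv2 1 0, 1%g).
Proof.
rewrite /derivation_ker /= /cocycle_line /= expb1 expa1 parity0 !mul0r !addr0 mul1r.
by rewrite /linform cv2_0 cv2_1 mulr0 addr0 => /eqP; rewrite oner_eq0.
Qed.

Lemma trans_cocycle_sgn y :
  ~ derivation_ker (@cocycle_sgn k p y) (cv2 1 0, 1%g).
Proof.
rewrite /derivation_ker /= /cocycle_sgn /= expb1 sg0 subrr mul0r addr0.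
by rewrite /linform cv2_0 cv2_1 mulr0 addr0 => /eqP; rewrite oner_eq0.
Qed.

Lemma b_cocycle_line0 x : ~ derivation_ker (@cocycle_line k p 0 1 x) (0, G2_b).
Proof.
rewrite /derivation_ker /= /cocycle_line /= expb_b expa_b parity0 !mul0r addr0 add0r.
by rewrite mulr1 => /eqP; rewrite oner_eq0.
Qed.

Lemma b_cocycle_expa : derivation_ker (@cocycle_expa k p) (0, G2_b).
Proof. by rewrite /derivation_ker /= /cocycle_expa /= expa_b. Qed.

(** The maximal subgroups above Z^2 contribute p + 1 for every k: [None] is the one containing b,
    and the [inr] are the p others. Membership of the translation by (1, 0) separates these from the
    family [g], the only part depending on k. *)
Lemma count_index_prime (T : finType) (g : T -> set (H k)) :
    injective g -> (forall t, maximal_subgroups (H k) p (g t)) ->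
    (forall t, ~ g t (cv2 1 0, 1%g)) ->
    (forall M, maximal_subgroups (H k) p M -> (exists v, ~ M (v, 1%g)) ->
       exists t, M = g t) ->
  maximal_subgroups (H k) p #= `I_(#|T| + p).+1.
Proof.
move=> g_inj g_max g_trans g_surj.
pose f (t : option (T + 'F_p)) : set (H k) := match t with
  | None => derivation_ker (@cocycle_expa k p)
  | Some (inl t) => g t
  | Some (inr x) => derivation_ker (@cocycle_line k p 0 1 x)
  end.
have f_inj : injective f.
  move=> [[t|x]|] [[t'|x']|] //= e.
  - by rewrite (g_inj _ _ e).
  - by case: (g_trans t); rewrite e; exact: trans_cocycle_line0.
  - by case: (g_trans t); rewrite e; exact: trans_cocycle_expa.
  - by case: (g_trans t'); rewrite -e; exact: trans_cocycle_line0.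
  - by rewrite (@cocycle_line0_inj k p x x' e).
  - by case: (@b_cocycle_line0 x); rewrite e; exact: b_cocycle_expa.
  - by case: (g_trans t'); rewrite -e; exact: trans_cocycle_expa.
  - by case: (@b_cocycle_line0 x'); rewrite -e; exact: b_cocycle_expa.
have -> : maximal_subgroups (H k) p = range f.
  apply/seteqP; split=> [M maxM|_ [[[t|x]|] _ <-]] /=.
  - have [MN|MN] := pselect (exists v, ~ M (v, 1%g)).
      by have [t ->] := g_surj M maxM MN; exists (Some (inl t)).
    have [_ [->|[x ->]]] := classify_not_typeI maxM MN; first by exists None.
    by exists (Some (inr x)).
  - exact: g_max.
  - by apply: cocycle_line_maximal => //; right.
  - exact: cocycle_expa_maximal.
have -> : (#|T| + p).+1 = #|{: option (T + 'F_p)}|.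
  by rewrite card_option card_sum card_Fp.
exact: card_range_finType.
Qed.

Lemma count_line : k%:~R = 2 :> 'F_p ->
  maximal_subgroups (H k) p #= `I_(p ^ 2 + p + 1).
Proof.
move=> k2; rewrite addn1.
have -> : (p ^ 2)%N = #|{: 'F_p * 'F_p}| by rewrite card_prod card_Fp.
apply: (count_index_prime (@cocycle_line1_inj k p)) => [t|t|M maxM MN].
- by apply: cocycle_line_maximal => //; left.
- exact: trans_cocycle_line1.
- have [q q_pr [[pq _ [t ->]]|[pq kN2 two _]|[pq _ _]]] := classify_typeI maxM MN.
  + by move: t; rewrite -pq => t; exists t.
  + by move: kN2 two; rewrite -pq k2 => kN2 /Fp_2_neqN2.
  + by case: (prime_expn2 p_pr pq).
Qed.

Lemma count_sgn : k%:~R = -2 :> 'F_p -> (2 < p)%N ->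
  maximal_subgroups (H k) p #= `I_(2 * p + 1).
Proof.
move=> k2; rewrite -Fp_2_neq0 // => two; rewrite addn1 mul2n -addnn.
rewrite -[p in (p + _)%N](card_Fp p_pr).
apply: (count_index_prime (cocycle_sgn_inj (k := k) two)) => [t|t|M maxM MN].
- exact: cocycle_sgn_maximal.
- exact: trans_cocycle_sgn.
- have [q q_pr [[pq k2' _]|[pq kN2 _ [y ->]]|[pq _ _]]] := classify_typeI maxM MN.
  + by move: k2'; rewrite -pq k2 => /esym/(Fp_2_neqN2 two).
  + by move: y; rewrite -pq => y; exists y.
  + by case: (prime_expn2 p_pr pq).
Qed.

(** When the plane is irreducible, a maximal subgroup not containing Z^2 has the square of a prime
    as index, so the family indexed by [T] is empty. *)
Lemma count_irr : k%:~R ^+ 2 != 4 :> 'F_p ->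
  maximal_subgroups (H k) p #= `I_(p + 1).
Proof.
move=> k4; rewrite addn1 -[p in p.+1]add0n -card_void.
apply: (@count_index_prime _ (fun t : void => match t with end)) => // M maxM MN.
have [q q_pr [[pq k2 _]|[pq k2 _ _]|[pq _ _]]] := classify_typeI maxM MN.
- by move: k4; rewrite pq k2 => /eqP; case; ring.
- by move: k4; rewrite pq k2 => /eqP; case; ring.
- by case: (prime_expn2 p_pr pq).
Qed.

(** A maximal subgroup containing Z^2 has prime index, so only the kernels of [cocycle_plane]
    remain. *)
Lemma count_plane : k%:~R ^+ 2 != 4 :> 'F_p ->
  maximal_subgroups (H k) (p ^ 2) #= `I_(p ^ 2).
Proof.
move=> k4.
have -> : maximal_subgroups (H k) (p ^ 2) =
    range (fun w => derivation_ker (@cocycle_plane k p w)).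
  apply/seteqP; split=> [M maxM|_ [w _ <-]]; last exact: cocycle_plane_maximal.
  have [MN|MN] := pselect (exists v, ~ M (v, 1%g)); last first.
    by have [/prime_expn2/(_ erefl)] := classify_not_typeI maxM MN.
  have [q q_pr [[pq _ _]|[pq _ _ _]|[pq _ [w ->]]]] := classify_typeI maxM MN.
  - by case: (prime_expn2 q_pr (esym pq)).
  - by case: (prime_expn2 q_pr (esym pq)).
  - by move: w; rewrite -(expn2_inj pq) => w; exists w.
have e : (p ^ 2)%N = #|{: 'cV['F_p]_2}| by rewrite card_mx card_Fp // muln1.
by rewrite e; apply/card_range_finType/cocycle_plane_inj.
Qed.

End Counts.

Theorem theorem3p6 (k : int) (n : nat) (n_gt0 : (0 < n)%N) :
  let m_eq (c : nat) := maximal_subgroups (H k) n #= `I_c in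
  let case1 := exists p : nat,
    [/\ prime p, n = p & (p%:Z %| k - 2)%Z] in
  let case2 := exists p : nat,
    [/\ prime p, n = p, (p%:Z %| k + 2)%Z & (2 < p)%N] in
  let case3 := exists p : nat,
    [/\ prime p, n = p & ~~ (p%:Z %| (k - 2) * (k + 2))%Z] in
  let case4 := exists p : nat,
    [/\ prime p, n = (p ^ 2)%N & ~~ (p%:Z %| (k - 2) * (k + 2))%Z] in
  [/\ case1 -> m_eq (n ^ 2 + n + 1)%N,
      case2 -> m_eq (2 * n + 1)%N,
      case3 -> m_eq (n + 1)%N,
      case4 -> m_eq n &
      ~ (case1 \/ case2 \/ case3 \/ case4) -> m_eq 0%N].
Proof.
move=> m_eq case1 case2 case3 case4; rewrite /m_eq; split.
- by move=> [p [p_pr -> /(dvdz_sub2 _ p_pr)]]; exact: count_line.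
- by move=> [p [p_pr -> /(dvdz_add2 _ p_pr)]]; exact: count_sgn.
- by move=> [p [p_pr ->]]; rewrite dvdz_mul22 //; exact: count_irr.
- by move=> [p [p_pr ->]]; rewrite dvdz_mul22 //; exact: count_plane.
- move=> no_case; rewrite II0 card_eq0; apply/eqP/seteqP.
  split=> // M maxM; apply: no_case.
  have [MN|MN] := pselect (exists v, ~ M (v, 1%g)).
    have [p p_pr [[np k2 _]|[np k2 two _]|[np k4 _]]] := classify_typeI maxM MN.
    + by left; exists p; split=> //; exact/dvdz_sub2.
    + right; left; exists p; split=> //; first exact/dvdz_add2.
      by rewrite -Fp_2_neq0.
    + by right; right; right; exists p; split=> //; rewrite dvdz_mul22.
  (* [M] contains Z^2, so n is prime, and every prime falls under one of the first three cases. *)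
  have [n_pr _] := classify_not_typeI maxM MN.
  have [k4|k4] := boolP (n%:Z %| (k - 2) * (k + 2))%Z; last first.
    by right; right; left; exists n.
  move: k4; rewrite dvdz_mul22 // => /eqP/Fp_sqr_eq4[k2|[kN2 two]].
    by left; exists n; split=> //; exact/dvdz_sub2.
  right; left; exists n; split=> //; first exact/dvdz_add2.
  by rewrite -Fp_2_neq0.
Qed.
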